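(* Let $T_i:\mathcal{E}\to\mathcal{E}$ be nonexpansive for every $i\in I$, and assume $\operatorname{inv}\mathcal{P}\neq\emptyset$. Let $\mu\in\mathscr{P}(\mathcal{E})$ and $\nu_k=\frac1k\sum_{j=1}^k\mu\mathcal{P}^j$ for $k\ge 1$. Then the sequence $(\nu_k)$ converges in the Prokhorov-Lévy metric to an invariant probability measure $\pi^\mu$ for $\mathcal{P}$, where $$\pi^\mu=\int_{\operatorname{supp}\mu}\pi^x\,\mu(dx),$$ and where for each $x\in\operatorname{supp}\mu$ the limit of the sequence $(\nu_k^x)$, $\nu_k^x:=\frac1k\sum_{j=1}^k\delta_x\mathcal{P}^j$, exists and is denoted by the invariant measure $\pi^x$.
   Context: $\mathcal{E}$ is a Euclidean space (finite-dimensional real inner product space) with its Borel $\sigma$-algebra $\mathcal{B}(\mathcal{E})$; $\mathscr{P}(\mathcal{E})$ is the set of Borel probability measures on $\mathcal{E}$; $\operatorname{supp}\mu$ is the smallest closed set of full $\mu$-measure. $(I,\mathcal{I})$ is a measurable space, $\xi$ is an $I$-valued random variable on a probability space $(\Omega,\mathcal{F},\mathbb{P})$, and the map $(x,i)\mapsto T_ix$, $\mathcal{E}\times I\to\mathcal{E}$, is measurable. The transition kernel is $p(x,A)=\mathbb{P}(T_\xi x\in A)$; the associated Markov operator $\mathcal{P}$ acts on functions by $\mathcal{P}f(x)=\int f(y)\,p(x,dy)$ and on measures by $(\mu\mathcal{P})(A)=\int p(x,A)\,\mu(dx)$; $\mu\mathcal{P}^k$ is the $k$-fold iterate. $\operatorname{inv}\mathcal{P}=\{\pi\in\mathscr{P}(\mathcal{E}):\pi\mathcal{P}=\pi\}$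 is the set of invariant probability measures. $T_i$ is nonexpansive if $\|T_ix-T_iy\|\le\|x-y\|$ for all $x,y$. The Prokhorov-Lévy metric is $d_P(\mu,\nu)=\inf\{\epsilon>0:\mu(A)\le\nu(\mathbb{B}(A,\epsilon))+\epsilon,\ \nu(A)\le\mu(\mathbb{B}(A,\epsilon))+\epsilon\ \forall A\in\mathcal{B}(\mathcal{E})\}$, with $\mathbb{B}(A,\epsilon)=\bigcup_{x\in A}\{y:\|x-y\|<\epsilon\}$. *)

(* Defs.v *)
From HB Require Import structures.
From mathcomp Require Import all_boot all_order all_algebra.
From mathcomp Require Import all_classical all_reals all_analysis.
From mathcomp Require Import measurable_realfun.

Set Implicit Arguments.
Unset Strict Implicit.
Unset Printing Implicit Defensive.

Import Order.TTheory GRing.Theory Num.Theory.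
Import numFieldNormedType.Exports.

Local Open Scope classical_set_scope.
Local Open Scope ring_scope.

(* Finite-dimensionality is the Vector structure; the norm of the NormedModule
   structure, hence the topology, is required to be the one of inner. *)
HB.mixin Record NormedVector_isEuclidean (R : realType) E
    of NormedModule R E & Vector R E := {
  inner : {dot E for (@idfun R)} ;
  norm_innerE : forall x : E, `|x| = Num.sqrt (inner x x)
}.

#[short(type="euclideanType")]
HB.structure Definition Euclidean (R : realType) :=
  {E of NormedModule R E & Vector R E & NormedVector_isEuclidean R E}.

Notation borel E := (g_sigma_algebraType (@open E)).

Section euclidean_defs.
Context (R : realType) (E : euclideanType R).

Definition nonexpansive (f : E -> E) := forall x y, `|f x - f y| <= `|x - y|.

Definition thickening (A : set E) (e : R) : set E :=
  \bigcup_(x in A) [set y | `|x - y| < e].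

(* On probability measures the set contains every e > 1, hence the real inf is
   the infimum. *)
Definition prokhorov (mu nu : probability (borel E) R) : R :=
  inf [set e | 0 < e /\ forall A : set (borel E), measurable A ->
    (mu A <= nu (thickening A e) + e%:E)%E /\
    (nu A <= mu (thickening A e) + e%:E)%E].

Definition prokhorov_cvg (nu : nat -> probability (borel E) R)
    (pi : probability (borel E) R) :=
  prokhorov (nu k) pi @[k --> \oo] --> (0 : R).

Definition supp (mu : probability (borel E) R) : set E :=
  \bigcap_(C in [set C : set E | closed C /\ mu C = 1%E]) C.

End euclidean_defs.

Section markov.
Context (R : realType) (E : euclideanType R) (dO dI : measure_display)
  (Omega : measurableType dO) (I : measurableType dI).
Variables (P : probability Omega R) (xi : {RV P >-> I})
  (T : {mfun (borel E * I)%type >-> borel E}).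

Local Lemma measurable_step : measurable_fun [set: borel E * Omega]
  (fun z => T (z.1, xi z.2)).
Proof.
apply: (measurableT_comp (f := T)) => //.
apply: measurable_fun_pair; first exact: measurable_fst.
by apply: (measurableT_comp (f := xi)) => //; exact: measurable_snd.
Qed.

Local Lemma measurable_stepx (x : borel E) :
  measurable_fun [set: Omega] (fun w => T (x, xi w)).
Proof. exact: measurableT_comp measurable_step (pair1_measurable x). Qed.

Definition transition (x : borel E) (A : set (borel E)) : \bar R :=
  P [set w | A (T (x, xi w))].

Section transition_probability.
Variable x : borel E.

Let transition0 : transition x set0 = 0%E.
Proof. exact: measure0. Qed.

Let transition_ge0 A : (0 <= transition x A)%E.
Proof. exact: measure_ge0. Qed.

Let transition_sigma_additive : semi_sigma_additive (transition x).
Proof.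
move=> F mF tF mUF; rewrite /transition -/(preimage _ _) preimage_bigcup.
apply: measure_semi_sigma_additive.
- by move=> n; rewrite -[X in measurable X]setTI; exact: measurable_stepx.
- apply/trivIsetP => i j _ _ ij; rewrite -preimage_setI.
  by move/trivIsetP : tF => -> //; rewrite preimage_set0.
- by rewrite -preimage_bigcup -[X in measurable X]setTI; exact: measurable_stepx.
Qed.

HB.instance Definition _ := isMeasure.Build _ _ _ (transition x)
  transition0 transition_ge0 transition_sigma_additive.

Let transition_setT : transition x setT = 1%E.
Proof. exact: probability_setT. Qed.

HB.instance Definition _ :=
  Measure_isProbability.Build _ _ _ (transition x) transition_setT.

End transition_probability.

Lemma measurable_transition (A : set (borel E)) : measurable A ->
  measurable_fun [set: borel E] (transition ^~ A).
Proof.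
move=> mA.
have mS : measurable ((fun z : borel E * Omega => T (z.1, xi z.2)) @^-1` A).
  by rewrite -[X in measurable X]setTI; exact: measurable_step.
have := measurable_fun_xsection P mS.
by apply: eq_measurable_fun => x _ /=; rewrite xsectionE.
Qed.

Section markov_op_probability.
Variable mu : probability (borel E) R.

Definition markov_op (A : set (borel E)) : \bar R := \int[mu]_x transition x A.

Let markov0 : markov_op set0 = 0%E.
Proof. by apply: integral0_eq => x _; exact: (measure0 (transition x)). Qed.

Let markov_ge0 A : (0 <= markov_op A)%E.
Proof. by apply: integral_ge0 => x _; exact: (measure_ge0 (transition x)). Qed.

Let markov_sigma_additive : semi_sigma_additive markov_op.
Proof.
move=> F mF tF mUF.
rewrite [X in _ --> X](_ : _ =
    \int[mu]_x \sum_(0 <= k <oo) transition x (F k))%E; last first.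
  apply: eq_integral => x _.
  by apply/esym/cvg_lim => //; exact: measure_semi_sigma_additive.
rewrite integral_nneseries //; last by move=> n; exact: measurable_transition.
by apply: is_cvg_nneseries => n _ _; exact: markov_ge0.
Qed.

HB.instance Definition _ := isMeasure.Build _ _ _ markov_op
  markov0 markov_ge0 markov_sigma_additive.

Let markov_setT : markov_op setT = 1%E.
Proof.
rewrite /markov_op.
under eq_integral => x _ do rewrite (probability_setT (transition x)).
by rewrite integral_cst// mul1e; exact: probability_setT.
Qed.

HB.instance Definition _ :=
  Measure_isProbability.Build _ _ _ markov_op markov_setT.

End markov_op_probability.

Definition markov_iter (mu : probability (borel E) R) (j : nat) :
  probability (borel E) R := iter j (fun nu => markov_op nu) mu.

Definition invariant_probability (pi : probability (borel E) R) :=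
  forall A : set (borel E), measurable A -> markov_op pi A = pi A.

Section cesaro.
Variables (mu : probability (borel E) R) (k : nat).

(* Indexed from 0 so that every term is a probability: cesaro_mean mu k is the
   average of the first k + 1 iterates mu P^1, ..., mu P^(k+1). *)
Definition cesaro_mean (A : set (borel E)) : \bar R :=
  ((k.+1%:R^-1)%:E * \sum_(1 <= j < k.+2) markov_iter mu j A)%E.

Let cesaroE A : cesaro_mean A =
  mscale (k.+1%:R^-1)%:nng (msum (fun j => markov_iter mu j.+1) k.+1) A.
Proof.
rewrite /cesaro_mean /mscale /= /msum; congr (_ * _)%E.
by rewrite big_add1 big_mkord.
Qed.

Let cesaro0 : cesaro_mean set0 = 0%E.
Proof. by rewrite cesaroE measure0. Qed.

Let cesaro_ge0 A : (0 <= cesaro_mean A)%E.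
Proof. by rewrite cesaroE. Qed.

Let cesaro_sigma_additive : semi_sigma_additive cesaro_mean.
Proof.
rewrite (_ : cesaro_mean = mscale (k.+1%:R^-1)%:nng
    (msum (fun j => markov_iter mu j.+1) k.+1)); last exact/funext/cesaroE.
exact: measure_semi_sigma_additive.
Qed.

HB.instance Definition _ := isMeasure.Build _ _ _ cesaro_mean
  cesaro0 cesaro_ge0 cesaro_sigma_additive.

Let cesaro_setT : cesaro_mean setT = 1%E.
Proof.
rewrite /cesaro_mean; under eq_bigr do rewrite probability_setT.
rewrite sumEFin -EFinM; congr EFin.
by rewrite big_const_nat subn1 iter_addr_0 /= mulVf.
Qed.

HB.instance Definition _ :=
  Measure_isProbability.Build _ _ _ cesaro_mean cesaro_setT.

End cesaro.

End markov.

(* Main.v *)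
From HB Require Import structures.
Require Import Defs.
From mathcomp Require Import all_boot all_order all_algebra.
From mathcomp Require Import all_classical all_reals all_analysis.
From mathcomp Require Import measurable_realfun giry.
From mathcomp Require Import lra ring.

(** Write Q for the Markov operator on functions, A_k f for the average of
    Q f, ..., Q^(k+1) f, and call a [0, 1]-valued Lipschitz function a test
    function.  Nonexpansiveness means that Q, hence every A_k, maps L-Lipschitz
    test functions to L-Lipschitz test functions: for a fixed test function f the
    family (A_k f) is equicontinuous.  The integral of f against the k-th Cesaro
    mean started from mu is the mu-integral of A_k f, so everything reduces to
    the behaviour of A_k f.

    Tightness.  If pi is invariant, the same Lipschitz estimate compares Q^j g(x)
    with the pi-average of Q^j g, which is the pi-average of g.  For g a Lipschitz
    cutoff at infinity this bounds the mass that the chain started at x gives to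
    the complement of a large ball, uniformly in time (iter_tail_le).

    Pointwise convergence of A_k f (cesaro_fun_cvg).  Bounded sets of E are
    totally bounded, so by the Arzela-Ascoli argument (unit_lipschitz_subsequence)
    some A_m f is close, on a given ball, to A_m' f for infinitely many m'.  For k
    much larger than m, and then m' much larger than k, one has
      A_k f ~ A_k A_m f ~ A_k A_m' f = A_m' A_k f ~ A_m' f ~ A_m f    at x,
    where the first and third approximations are instances of the telescoping
    estimate |A_k A_m f - A_k f| <= (m + 1) / (k + 1), the second one follows from
    tightness, and the last one from the choice of m and m'.  Hence (A_k f(x)) is Cauchy
    for every x, with no appeal to weak compactness and no restriction on x.

    Limit measures (tight_weak_limit).  For a tight sequence of probabilities
    whose integrals of test functions all converge, the limit functional is
    represented by a probability: this is the Riesz construction, where the mass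
    of an open set is the supremum of the functional over the test functions
    living on it, and tightness replaces compactness of the space.  Applied to
    the chain started at x this gives pi_x; its invariance follows from
    |A_k Q f - A_k f| <= 1 / (k + 1).  Integrating pi_x over mu gives pi_mu, and
    dominated convergence shows that it is the limit for the chain started
    from mu.  Weak convergence against test functions is finally upgraded to
    Prokhorov convergence (weak_prokhorov) by looking at the finitely many unions
    of small balls that cover most of the mass of the limit, and the integral is
    restricted to supp mu, whose complement is a countable union of null
    balls. *)

Set Implicit Arguments.
Unset Strict Implicit.
Unset Printing Implicit Defensive.
Import Order.TTheory GRing.Theory Num.Theory.
Import numFieldNormedType.Exports.
Local Open Scope classical_set_scope.
Local Open Scope ring_scope.

(** * Compactness of bounded sets *)

Section euclidean_compactness.
Context (R : realType) (E : euclideanType R).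
Import VectorInternalTheory.

Let n := dim E.

Let continuous_r2v : continuous (@r2v R E).
Proof.
rewrite (_ : @r2v R E = fun v : 'rV[R]_n =>
    \sum_i v 0 i *: @r2v R E (delta_mx 0 i)); last first.
  apply/funext => v; rewrite [in LHS](row_sum_delta v) linear_sum.
  by apply: eq_bigr => i _; rewrite linearZ.
apply: (@continuous_big _ _ _ _ _ add_continuous) => i _ v.
have ci := @coord_continuous R 1 n 0 i v; exact: (cvgZr_tmp ci).
Qed.

(** Half of the equivalence of norms in finite dimension: the norm of E, read in
    coordinates, is continuous and positive on the compact unit sphere. *)
Let r2v_lower_bound : exists2 c : R, 0 < c &
  forall v : 'rV[R]_n, c * `|v| <= `|@r2v R E v|.
Proof.
pose S := [set v : 'rV[R]_n | `|v| = 1].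
have cN : continuous (fun v : 'rV[R]_n => `|@r2v R E v|).
  move=> v; exact: (cvg_norm (@continuous_r2v v)).
have [S0|] := pselect (S !=set0); last first.
  move=> S0; exists 1 => // v; have [->|v0] := eqVneq v 0.
    by rewrite normr0 mulr0.
  exfalso; apply: S0; exists (`|v|^-1 *: v).
  by rewrite /S/= normrZ ger0_norm ?invr_ge0// mulVf// normr_eq0.
have cS : compact S.
  apply: bounded_closed_compact.
    by exists 1; split => // x x1 v /= ->; exact: ltW.
  rewrite (_ : S = (fun v : 'rV[R]_n => `|v|) @^-1` [set 1]); last by [].
  apply: (@preimage_closed _ _ (fun v : 'rV[R]_n => `|v|)); last exact: closed_eq.
  by move=> v _; exact: norm_continuous.
have [c /[!inE] Sc cmin] := compact_EVT_min S0 cS (continuous_subspaceT cN).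
have c0 : c != 0 by apply: contra_eq_neq Sc => ->; rewrite normr0 eq_sym oner_eq0.
exists `|@r2v R E c|.
  rewrite normr_gt0; apply: contra_neq c0 => c0.
  by apply: r2v_inj; rewrite c0 linear0.
move=> v; have [->|v0] := eqVneq v 0; first by rewrite normr0 mulr0.
have vgt0 : 0 < `|v| by rewrite normr_gt0.
rewrite -ler_pdivlMr//.
have := cmin (`|v|^-1 *: v); rewrite inE/= /S/=.
rewrite linearZ/= !normrZ ger0_norm ?invr_ge0// mulVf ?normr_eq0//.
by rewrite [X in _ <= X]mulrC; exact.
Qed.

Lemma compact_closed_ball0 (M : R) : compact [set x : E | `|x| <= M].
Proof.
have [c c0 cE] := r2v_lower_bound.
rewrite (_ : [set x | _] = (@r2v R E) @`
    [set v | `|@r2v R E v| <= M]); last first.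
  apply/seteqP; split => [x xM|x [v vM <-//]].
  by exists (v2r x); rewrite /= ?v2rK.
apply: continuous_compact; first exact/continuous_subspaceT.
apply: bounded_closed_compact.
  exists (M / c); split => [|x Mx v /= vM]; first exact: num_real.
  by rewrite (le_trans _ (ltW Mx))// ler_pdivlMr// mulrC (le_trans (cE v)).
rewrite (_ : [set v | _] = (fun v : 'rV[R]_n => `|@r2v R E v|) @^-1` [set x | x <= M]);
  last by [].
apply: preimage_closed; last exact: closed_le.
move=> v _; exact: (cvg_norm (@continuous_r2v v)).
Qed.

Lemma finite_net (M d : R) : 0 < d -> exists s : seq E,
  forall x : E, `|x| <= M -> exists2 y, y \in s & `|x - y| < d.
Proof.
move=> d0; have := @compact_closed_ball0 M; rewrite compact_cover.
move=> /(_ E setT (fun y => ball y d))[| |D _ MD].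
- by move=> y _; exact: ball_open.
- by move=> x _; exists x => //; exact: ballxx.
- exists (finmap.enum_fset D) => x /MD[y/= yD]; rewrite -ball_normE/= => yx.
  by exists y => //; rewrite distrC.
Qed.

End euclidean_compactness.

(** * Expectations of bounded functions *)

Section bounded_measurable.
Context d (T : measurableType d) (R : realType).
Implicit Types (f g : T -> R) (nu : probability T R).

Definition bounded_measurable f :=
  measurable_fun setT f /\ exists C, forall x, `|f x| <= C.

Lemma bounded_measurable_cst c : bounded_measurable (fun=> c).
Proof. by split => //; exists `|c|. Qed.

Lemma bounded_measurableD f g : bounded_measurable f -> bounded_measurable g ->
  bounded_measurable (fun x => f x + g x).
Proof.
move=> [mf [C fC]] [mg [D gD]]; split; first exact: measurable_funD.
by exists (C + D) => x; rewrite (le_trans (ler_normD _ _))// lerD.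
Qed.

Lemma bounded_measurableZ c f : bounded_measurable f ->
  bounded_measurable (fun x => c * f x).
Proof.
move=> [mf [C fC]]; split; first exact: measurable_funM.
by exists (`|c| * C) => x; rewrite normrM ler_wpM2l.
Qed.

Lemma bounded_measurableB f g : bounded_measurable f -> bounded_measurable g ->
  bounded_measurable (fun x => f x - g x).
Proof.
move=> bf bg; rewrite (_ : (fun x => _) = fun x => f x + -1 * g x).
  exact/bounded_measurableD/bounded_measurableZ.
by apply/funext => x; rewrite mulN1r.
Qed.

Lemma bounded_measurable_sum (I : Type) (s : seq I) (F : I -> T -> R) :
  (forall i, bounded_measurable (F i)) ->
  bounded_measurable (fun x => \sum_(i <- s) F i x).
Proof.
move=> bF; elim: s => [|i s ih].
  under eq_fun do rewrite big_nil; exact: bounded_measurable_cst.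
by under eq_fun do rewrite big_cons; exact: bounded_measurableD.
Qed.

Lemma bounded_measurable_integrable nu f : bounded_measurable f ->
  nu.-integrable setT (EFin \o f).
Proof.
move=> [mf [C fC]]; apply: measurable_bounded_integrable => //.
  by rewrite (le_lt_trans (probability_le1 nu _))// ltry.
exists C; split; first exact: num_real.
by move=> x Cx y _ /=; rewrite (le_trans (fC y))// ltW.
Qed.

Lemma expect_cst nu c : \int[nu]_x c = c.
Proof. by rewrite Rintegral_cst//= probability_setT mulr1. Qed.

Lemma expectD nu f g : bounded_measurable f -> bounded_measurable g ->
  \int[nu]_x (f x + g x) = \int[nu]_x f x + \int[nu]_x g x.
Proof. by move=> *; apply: RintegralD => //; exact: bounded_measurable_integrable. Qed.

Lemma expectB nu f g : bounded_measurable f -> bounded_measurable g ->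
  \int[nu]_x (f x - g x) = \int[nu]_x f x - \int[nu]_x g x.
Proof. by move=> *; apply: RintegralB => //; exact: bounded_measurable_integrable. Qed.

Lemma expectZ nu c f : bounded_measurable f ->
  \int[nu]_x (c * f x) = c * \int[nu]_x f x.
Proof. by move=> *; apply: RintegralZl => //; exact: bounded_measurable_integrable. Qed.

Lemma expect_sum nu (I : Type) (s : seq I) (F : I -> T -> R) :
  (forall i, bounded_measurable (F i)) ->
  \int[nu]_x (\sum_(i <- s) F i x) = \sum_(i <- s) \int[nu]_x F i x.
Proof.
move=> bF; elim: s => [|i s ih].
  by rewrite big_nil -[RHS](expect_cst nu); apply: eq_Rintegral => x _; rewrite big_nil.
rewrite big_cons -ih -expectD//; last exact: bounded_measurable_sum.
by apply: eq_Rintegral => x _; rewrite big_cons.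
Qed.

Lemma le_expect nu f g : bounded_measurable f -> bounded_measurable g ->
  (forall x, f x <= g x) -> \int[nu]_x f x <= \int[nu]_x g x.
Proof.
by move=> bf bg fg; apply: le_Rintegral => //; exact: bounded_measurable_integrable.
Qed.

Lemma norm_expect_le nu f g : bounded_measurable f -> bounded_measurable g ->
  (forall x, `|f x| <= g x) -> `|\int[nu]_x f x| <= \int[nu]_x g x.
Proof.
move=> bf bg fg; rewrite ler_norml -mulN1r -expectZ// !le_expect//.
- by move=> x; rewrite (le_trans (ler_norm _)).
- exact: bounded_measurableZ.
- by move=> x; rewrite mulN1r lerNl (le_trans _ (fg x))// -normrN ler_norm.
Qed.

Lemma EFin_expect nu f : bounded_measurable f ->
  ((\int[nu]_x f x)%:E = \int[nu]_x (f x)%:E)%E.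
Proof.
move=> bf; rewrite /Rintegral fineK//; apply: integrable_fin_num => //.
exact: bounded_measurable_integrable.
Qed.

End bounded_measurable.
#[global] Hint Resolve bounded_measurable_cst : core.

Lemma expect_cvg d (T : measurableType d) (R : realType) (nu : probability T R)
    (f_ : nat -> T -> R) (f : T -> R) (C : R) :
  (forall n, measurable_fun setT (f_ n)) -> (forall n x, `|f_ n x| <= C) ->
  (forall x, f_ ^~ x @ \oo --> f x) ->
  \int[nu]_x f_ n x @[n --> \oo] --> \int[nu]_x f x.
Proof.
move=> mf_ f_C f_f.
have mf : measurable_fun setT f.
  by apply: measurable_fun_cvg => // x _; exact: f_f.
have bf : bounded_measurable f.
  split => //; exists C => x.
  have fx : `|f_ n x| @[n --> \oo] --> `|f x| by apply: cvg_norm; exact: f_f.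
  by apply: cvgr_to_le fx _; exact: nearW.
have := @dominated_convergence _ T R nu setT measurableT (fun n => EFin \o f_ n)
  (EFin \o f) (cst C%:E).
case.
- by move=> n; exact/measurable_EFinP.
- exact/measurable_EFinP.
- by apply: aeW => x _; apply/cvg_EFin; [exact: nearW|exact: f_f].
- exact/bounded_measurable_integrable/bounded_measurable_cst.
- by apply: aeW => x n _; rewrite lee_fin; exact: f_C.
move=> _ _ cv; apply: fine_cvg.
by rewrite EFin_expect//; exact: cv.
Qed.

(** * Lipschitz test functions *)

Lemma dist01_le1 (R : realDomainType) (a b : R) :
  0 <= a <= 1 -> 0 <= b <= 1 -> `|a - b| <= 1.
Proof. by rewrite ler_norml; lra. Qed.

Section unit_lipschitz.
Context (R : realType) (E : euclideanType R).
Implicit Types (f g : E -> R) (L : R).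

Definition unit_lipschitz L f :=
  (forall x, 0 <= f x <= 1) /\ forall x y, `|f x - f y| <= L * `|x - y|.

Lemma unit_lipschitz_ge0 L f x : unit_lipschitz L f -> 0 <= f x.
Proof. by case=> /(_ x)/andP[]. Qed.

Lemma unit_lipschitz_le1 L f x : unit_lipschitz L f -> f x <= 1.
Proof. by case=> /(_ x)/andP[]. Qed.

Lemma unit_lipschitz_continuous L f : unit_lipschitz L f -> continuous f.
Proof.
move=> [_ fL] x; apply/cvgrPdist_le => e e0.
have L1 : 0 < `|L| + 1 by rewrite ltr_pwDr.
near=> y; rewrite (le_trans (fL _ _))//.
rewrite (@le_trans _ _ ((`|L| + 1) * `|x - y|))//.
  by rewrite ler_wpM2r// (le_trans (ler_norm _))// lerDl.
rewrite -ler_pdivlMl// mulrC.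
by near: y; apply: cvgr_dist_le; [exact: cvg_id|rewrite divr_gt0].
Unshelve. all: by end_near. Qed.

Lemma continuous_borel f : continuous f ->
  measurable_fun [set: borel E] (f : borel E -> R).
Proof.
move=> cf; apply: (measurability _ (RGenOpens.measurableE R)).
move=> _ [_ [a [b ->] <-]]; rewrite setTI; apply: sub_sigma_algebra.
by move/continuousP : cf; apply; exact: interval_open.
Qed.

Lemma open_borel (A : set E) : open A -> measurable (A : set (borel E)).
Proof. exact: sub_sigma_algebra. Qed.

Lemma unit_lipschitz_bounded_measurable L f : unit_lipschitz L f ->
  bounded_measurable (f : borel E -> R).
Proof.
move=> Lf; split; first by apply: continuous_borel; exact: unit_lipschitz_continuous Lf.
by exists 1 => x; rewrite ger0_norm ?(unit_lipschitz_ge0 _ Lf)// (unit_lipschitz_le1 _ Lf).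
Qed.

Lemma expect_unit_lipschitz (nu : probability (borel E) R) L f : unit_lipschitz L f ->
  0 <= \int[nu]_x f x <= 1.
Proof.
move=> Lf; have bf := unit_lipschitz_bounded_measurable Lf.
apply/andP; split.
  by apply: Rintegral_ge0 => x _; exact: unit_lipschitz_ge0 Lf.
rewrite -[leRHS](expect_cst nu); apply: le_expect => // x.
exact: unit_lipschitz_le1 Lf.
Qed.

Lemma unit_lipschitzC L f : unit_lipschitz L f -> unit_lipschitz L (fun x => 1 - f x).
Proof.
move=> [f01 Lf]; split => [x|x y]; first by have := f01 x; lra.
by rewrite (_ : _ - _ = - (f x - f y)) ?normrN//; ring.
Qed.

Definition clip (t : R) : R := if t <= 0 then 0 else if 1 <= t then 1 else t.

Lemma clip01 t : 0 <= clip t <= 1.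
Proof. by rewrite /clip; case: (leP t 0) => ?; case: (leP 1 t) => ?; lra. Qed.

Lemma clip_lipschitz s t : `|clip s - clip t| <= `|s - t|.
Proof.
rewrite ler_norml /clip; case: (leP 0 (s - t)) => ?;
  [rewrite ger0_norm//|rewrite ltr0_norm//];
  case: (leP t 0) => ?; case: (leP s 0) => ?;
  case: (leP 1 t) => ?; case: (leP 1 s) => ?; lra.
Qed.

Lemma unit_lipschitz_clip L f : (forall x y, `|f x - f y| <= L * `|x - y|) ->
  unit_lipschitz L (fun x => clip (f x)).
Proof.
move=> Lf; split => [x|x y]; first exact: clip01.
exact: le_trans (clip_lipschitz _ _) (Lf _ _).
Qed.

End unit_lipschitz.

Section open_approximation.
Context (R : realType) (E : euclideanType R).
Implicit Types (O : set E) (n : nat).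

(** The largest n-Lipschitz function below the indicator of O. *)
Definition lower_envelope O n (x : E) : R :=
  inf [set \1_O y + n%:R * `|x - y| | y in [set: E]].

Let envelope_lbound O n x :
  lbound [set \1_O y + n%:R * `|x - y| | y in [set: E]] 0.
Proof. by move=> _ [y _ <-]; rewrite addr_ge0// mulr_ge0. Qed.

Let envelope_nonempty O n x :
  [set \1_O y + n%:R * `|x - y| | y in [set: E]] !=set0.
Proof. by exists (\1_O x + n%:R * `|x - x|); exists x. Qed.

Let envelope_le O n x y : lower_envelope O n x <= \1_O y + n%:R * `|x - y|.
Proof. by apply: ge_inf; [exists 0; exact: envelope_lbound|exists y]. Qed.

Let le_envelope O n x c : (forall y, c <= \1_O y + n%:R * `|x - y|) ->
  c <= lower_envelope O n x.
Proof.
by move=> cO; apply: lb_le_inf; [exact: envelope_nonempty|move=> _ [y _ <-]].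
Qed.

Lemma lower_envelope_le_indic O n x : lower_envelope O n x <= \1_O x.
Proof. by rewrite (le_trans (envelope_le O n x x))// subrr normr0 mulr0 addr0. Qed.

Lemma lower_envelope_unit_lipschitz O n :
  unit_lipschitz n%:R (lower_envelope O n).
Proof.
have le1 x y : lower_envelope O n x <= lower_envelope O n y + n%:R * `|x - y|.
  rewrite -lerBlDr; apply: le_envelope => z.
  rewrite lerBlDr (le_trans (envelope_le O n x z))// -addrA lerD2l -mulrDr.
  by rewrite ler_wpM2l// [leRHS]addrC ler_distD.
split => [x|x y].
  apply/andP; split; last first.
    by rewrite (le_trans (lower_envelope_le_indic _ _ _))// indicE lern1 leq_b1.
  by apply: le_envelope => y; rewrite addr_ge0// mulr_ge0.
rewrite ler_distl lerBlDr le1 andbT [`|x - y|]distrC; exact: le1.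
Qed.

Lemma lower_envelope_nondecreasing O x m n : (m <= n)%N ->
  lower_envelope O m x <= lower_envelope O n x.
Proof.
move=> mn; apply: le_envelope => y; rewrite (le_trans (envelope_le _ _ _ y))//.
by rewrite lerD2l ler_wpM2r// ler_nat.
Qed.

(** Around a point of O, the indicator drops below 1 only at distance at least
    some r > 0, where the penalty n * r is eventually larger than 1. *)
Lemma lower_envelope_eq1 O x : open O -> O x ->
  \forall n \near \oo, lower_envelope O n x = 1.
Proof.
move=> oO Ox; have /nbhs_ballP[r/= r0 rO] := open_nbhs_nbhs (conj oO Ox).
near=> n; apply/eqP; rewrite eq_le.
have [/(_ x)/andP[_ ->] _ /=] := lower_envelope_unit_lipschitz O n.
apply: le_envelope => y; have [xy|xy] := ltP `|x - y| r.
  by rewrite indicE mem_set ?lerDl ?mulr_ge0//; apply: rO; rewrite -ball_normE.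
rewrite (@le_trans _ _ (n%:R * r))//; last first.
  by rewrite (@le_trans _ _ (n%:R * `|x - y|)) ?lerDr// ler_wpM2l.
rewrite -ler_pdivrMr//; near: n; exact: nbhs_infty_ger.
Unshelve. all: by end_near. Qed.

Lemma lower_envelope_eq0 O n x : ~ O x -> lower_envelope O n x = 0.
Proof.
move=> Ox; apply/eqP; rewrite eq_le; apply/andP; split.
  by rewrite (le_trans (lower_envelope_le_indic O n x))// indicE memNset.
by have [/(_ x)/andP[]] := lower_envelope_unit_lipschitz O n.
Qed.

Lemma lower_envelope_cvg O x : open O ->
  lower_envelope O n x @[n --> \oo] --> (\1_O x : R).
Proof.
move=> oO; rewrite indicE; have [Ox|Ox] := pselect (O x).
  rewrite mem_set//; apply: cvg_near_cst; exact: lower_envelope_eq1.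
by rewrite memNset//; apply: cvg_near_cst; apply: nearW => n; exact: lower_envelope_eq0.
Qed.

Lemma expect_lower_envelope_cvg (nu : probability (borel E) R) O : open O ->
  \int[nu]_x lower_envelope O n x @[n --> \oo] --> fine (nu O).
Proof.
move=> oO; have -> : fine (nu O) = \int[nu]_x \1_O x.
  by rewrite /Rintegral integral_indic ?setIT//; exact: open_borel.
apply: (@expect_cvg _ _ _ _ _ _ 1) => [n|n x|x].
- by have [] := unit_lipschitz_bounded_measurable (lower_envelope_unit_lipschitz O n).
- have L := lower_envelope_unit_lipschitz O n.
  by rewrite ger0_norm ?(unit_lipschitz_ge0 _ L)// (unit_lipschitz_le1 _ L).
- exact: lower_envelope_cvg.
Qed.

Lemma probability_ext (m1 m2 : probability (borel E) R) :
  (forall A, open A -> m1 A = m2 A) -> forall A, measurable A -> m1 A = m2 A.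
Proof.
move=> m12 A mA; apply: (@measure_unique _ R (borel E) (@open E) (fun=> setT)) => //.
- exact: openI.
- by move=> _; exact: openT.
- by rewrite bigcup_const.
- by move=> _; rewrite (le_lt_trans (probability_le1 m1 _))// ltry.
Qed.

Lemma probability_ext_expect (m1 m2 : probability (borel E) R) :
  (forall L f, unit_lipschitz L f -> \int[m1]_x f x = \int[m2]_x f x) ->
  forall A, measurable A -> m1 A = m2 A.
Proof.
move=> m12; apply: probability_ext => A oA.
have mA : measurable (A : set (borel E)) by exact: open_borel.
rewrite -[LHS]fineK ?fin_num_measure// -[RHS]fineK ?fin_num_measure//.
congr EFin; have c1 := @expect_lower_envelope_cvg m1 A oA.
have := @expect_lower_envelope_cvg m2 A oA.
rewrite (_ : (fun n => _) = fun n => \int[m1]_x lower_envelope A n x); last first.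
  by apply/funext => n; apply/esym/m12; exact: lower_envelope_unit_lipschitz.
by move=> c2; exact: cvg_unique c1 c2.
Qed.

(** A Lipschitz substitute for the indicator of the complement of a large ball. *)
Definition tail (M : R) (x : E) : R := clip (`|x| / M).

Lemma tail_unit_lipschitz M : 0 < M -> unit_lipschitz M^-1 (tail M).
Proof.
move=> M0; apply: unit_lipschitz_clip => x y.
rewrite -mulrBl normrM [X in _ * X]gtr0_norm ?invr_gt0// mulrC.
by apply: ler_wpM2l; [rewrite invr_ge0 ltW|exact: ler_dist_dist].
Qed.

Lemma tail_eq1 M x : 0 < M -> M <= `|x| -> tail M x = 1.
Proof.
move=> M0 Mx; have x1 : 1 <= `|x| / M by rewrite ler_pdivlMr// mul1r.
by rewrite /tail /clip leNgt (lt_le_trans _ x1)//= x1.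
Qed.

Lemma tail_small (nu : probability (borel E) R) (e : R) : 0 < e ->
  \forall n \near \oo, \int[nu]_x tail n.+1%:R x <= e.
Proof.
move=> e0.
suff : \int[nu]_x tail n.+1%:R x @[n --> \oo] --> (0 : R).
  move=> /cvgrPdist_le/(_ _ e0); apply: filterS => n.
  by rewrite sub0r normrN; exact/le_trans/ler_norm.
rewrite -(expect_cst nu 0); apply: (@expect_cvg _ _ _ _ _ _ 1) => [n|n x|x].
- by have [] := unit_lipschitz_bounded_measurable (@tail_unit_lipschitz n.+1%:R (ltr0Sn _ _)).
- have L := @tail_unit_lipschitz n.+1%:R (ltr0Sn _ _).
  by rewrite ger0_norm ?(unit_lipschitz_ge0 _ L)// (unit_lipschitz_le1 _ L).
apply/cvgrPdist_le => d d0; near=> n.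
rewrite sub0r normrN.
have xnd : `|x| / n.+1%:R <= d.
  rewrite ler_pdivrMr// mulrC -ler_pdivrMr//.
  rewrite (@le_trans _ _ n%:R) ?ler_nat//.
  by near: n; exact: nbhs_infty_ger.
have xn0 : 0 <= `|x| / n.+1%:R by rewrite divr_ge0.
rewrite /tail/= ger0_norm; last by case/andP: (clip01 (`|x| / n.+1%:R)).
move: (`|x| / _) xn0 xnd => t t0 td.
by rewrite /clip; case: (leP t 0) => ?; case: (leP 1 t) => ?; lra.
Unshelve. all: by end_near. Qed.

End open_approximation.

(** * Weak limits of tight sequences *)

Section weak_limit.
Context (R : realType) (E : euclideanType R).
Variable nu : nat -> probability (borel E) R.
Hypothesis nu_tight : forall e : R, 0 < e ->
  exists2 M : R, 0 < M & forall k, \int[nu k]_x tail M x <= e.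
Hypothesis nu_cvg : forall L (f : E -> R), unit_lipschitz L f ->
  cvgn (fun k => \int[nu k]_x f x).

Let test (f : E -> R) := exists L, unit_lipschitz L f.

(** The positive functional to be represented. *)
Let Lam (f : E -> R) := limn (fun k => \int[nu k]_x f x).

Let test_bm f : test f -> bounded_measurable (f : borel E -> R).
Proof. by move=> [L Lf]; exact: unit_lipschitz_bounded_measurable Lf. Qed.

Let LamP f : test f -> \int[nu k]_x f x @[k --> \oo] --> Lam f.
Proof. by move=> [L /nu_cvg]. Qed.

Let cvg_sumR (n : nat) (F : nat -> nat -> R) (l : nat -> R) :
  (forall i, F i k @[k --> \oo] --> l i) ->
  \sum_(i < n) F i k @[k --> \oo] --> \sum_(i < n) l i.
Proof. by move=> Fl; apply: cvg_big => //; exact: add_continuous. Qed.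

Let Lam_le_sum f g (h : nat -> E -> R) (c : R) (n : nat) :
    test f -> test g -> (forall i, test (h i)) ->
    (forall x, f x <= c + g x + \sum_(i < n) h i x) ->
  Lam f <= c + Lam g + \sum_(i < n) Lam (h i).
Proof.
move=> tf tg th fh.
have cr : c + \int[nu k]_x g x + \sum_(i < n) \int[nu k]_x h i x @[k --> \oo] -->
    c + Lam g + \sum_(i < n) Lam (h i).
  apply: cvgD; first by apply: cvgD; [exact: cvg_cst|exact: LamP].
  exact: (@cvg_sumR n (fun i k => \int[nu k]_x h i x) (fun i => Lam (h i))
    (fun i => LamP (th i))).
apply: (ler_cvg_to (LamP tf) cr); apply: nearW => k.
have bg := test_bm tg; have bh i := test_bm (th i); have bf := test_bm tf.
have bs : bounded_measurable (fun x : borel E => \sum_(i < n) h i x).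
  apply: (@bounded_measurable_sum _ (borel E) R 'I_n (index_enum 'I_n) (fun i => h i)).
  by move=> i; exact: bh.
rewrite -[X in X + _ + _](expect_cst (nu k) c) -expectD//.
rewrite -(@expect_sum _ _ _ (nu k) _ (index_enum 'I_n) (fun i => h i))//.
rewrite -expectD//; last exact: bounded_measurableD.
by apply: le_expect => //; apply: bounded_measurableD => //; exact: bounded_measurableD.
Qed.

Let sum_le_Lam f (h : nat -> E -> R) (a : R) (n : nat) :
    test f -> (forall i, test (h i)) ->
    (forall x, \sum_(i < n) h i x <= a * f x) ->
  \sum_(i < n) Lam (h i) <= a * Lam f.
Proof.
move=> tf th fh.
have cl : \sum_(i < n) \int[nu k]_x h i x @[k --> \oo] --> \sum_(i < n) Lam (h i).
  exact: (@cvg_sumR n (fun i k => \int[nu k]_x h i x) (fun i => Lam (h i))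
    (fun i => LamP (th i))).
have cr : a * \int[nu k]_x f x @[k --> \oo] --> a * Lam f.
  by apply: cvgM; [exact: cvg_cst|exact: LamP].
apply: (ler_cvg_to cl cr); apply: nearW => k.
have bh i := test_bm (th i); have bf := test_bm tf.
rewrite -expectZ// -(@expect_sum _ _ _ (nu k) _ (index_enum 'I_n) (fun i => h i))//.
apply: le_expect => //; last exact: bounded_measurableZ.
apply: (@bounded_measurable_sum _ (borel E) R 'I_n (index_enum 'I_n) (fun i => h i)).
  by move=> i; exact: bh.
Qed.

Let Lam_cst c : Lam (fun=> c) = c.
Proof.
rewrite /Lam (_ : (fun k => _) = fun=> c) ?lim_cst//.
by apply/funext => k; exact: expect_cst.
Qed.

Let test_cst c : 0 <= c <= 1 -> test (fun=> c).
Proof. by move=> c01; exists 0; split => // x y; rewrite subrr normr0 mul0r. Qed.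

Let Lam_le c f g : test f -> test g -> (forall x, f x <= c + g x) ->
  Lam f <= c + Lam g.
Proof.
move=> tf tg fg.
have t0 : test (fun=> 0) by apply: test_cst; rewrite lexx ler01.
have fg0 x : f x <= c + g x + \sum_(i < 0) 0 by rewrite big_ord0 addr0.
by have := @Lam_le_sum f g (fun _ _ => 0) c 0 tf tg (fun=> t0) fg0; rewrite big_ord0 addr0.
Qed.

Let Lam_ge0 f : test f -> 0 <= Lam f.
Proof.
move=> tf; rewrite -(Lam_cst 0) -[leRHS]add0r; apply: Lam_le => //.
  by apply: test_cst; rewrite lexx ler01.
by move=> x; rewrite add0r; case: tf => L Lf; exact: unit_lipschitz_ge0 Lf.
Qed.

(** Dini's theorem on a ball.  Together with tightness it gives the Lam-continuity
    from above that Daniell's approach to integration asks for. *)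
Let uniform_on_ball (F : nat -> E -> R) (e M : R) : (forall n, continuous (F n)) ->
  (forall m n x, (m <= n)%N -> F n x <= F m x) -> (forall x, exists n, F n x < e) ->
  exists n, forall x, `|x| <= M -> F n x < e.
Proof.
move=> cF dF Fe; have /compact_near_coveringP := @compact_closed_ball0 R E M.
move=> /(_ nat \oo (fun n x => F n x < e) _)[].
  move=> x _; have [N FN] := Fe x.
  have nx : \forall y \near x, F N y < e by apply: (cvgr_lt _ (cF N x)).
  exists ([set y | F N y < e], [set n | (N <= n)%N]) => /=.
    by split => //; exact: nbhs_infty_ge.
  by move=> [y n]/= [FNy Nn]; rewrite (le_lt_trans (dF _ _ _ Nn)).
by move=> N _ /(_ N (leqnn N)) H; exists N.
Qed.

Let supported (O : set E) f := test f /\ forall x, ~ O x -> f x = 0.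

Let open_mass (O : set E) : \bar R :=
  ereal_sup [set (Lam f)%:E | f in [set f | supported O f]].

Let Lam_le_open_mass O f : supported O f -> ((Lam f)%:E <= open_mass O)%E.
Proof. by move=> Of; apply: ereal_sup_ubound; exists f. Qed.

Let open_mass_le O c : (forall f, supported O f -> ((Lam f)%:E <= c)%E) ->
  (open_mass O <= c)%E.
Proof. by move=> Oc; apply: ge_ereal_sup => _ [f Of <-]; exact: Oc. Qed.

Let open_mass_ge0 O : (0 <= open_mass O)%E.
Proof.
have := @Lam_le_open_mass O (fun=> 0); rewrite Lam_cst; apply; split => //.
by apply: test_cst; rewrite lexx ler01.
Qed.

Let le_open_mass A B : A `<=` B -> (open_mass A <= open_mass B)%E.
Proof.
move=> AB; apply: open_mass_le => f [tf Af]; apply: Lam_le_open_mass.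
by split => // x /(contra_not (AB x)); exact: Af.
Qed.

Let open_mass_le1 O : (open_mass O <= 1)%E.
Proof.
apply: open_mass_le => f [tf _]; rewrite lee_fin -(Lam_cst 1) -[leRHS]add0r.
apply: Lam_le => //; first by apply: test_cst; rewrite lexx ler01.
by move=> x; rewrite add0r; case: tf => L Lf; exact: unit_lipschitz_le1 Lf.
Qed.

Let open_massT : open_mass setT = 1%E.
Proof.
apply/eqP; rewrite eq_le open_mass_le1/=.
have := @Lam_le_open_mass setT (fun=> 1); rewrite Lam_cst; apply; split => [|x].
  by apply: test_cst; rewrite lexx ler01.
by move=> /(_ I).
Qed.

Let test_envelope O n : test (lower_envelope O n).
Proof. by exists n%:R; exact: lower_envelope_unit_lipschitz. Qed.

(** If f lives on the union of the O i, the positive part of f minus the sum of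
    the first n envelopes of O 0, ..., O (n - 1) decreases to 0, so Dini and
    tightness bound f by that sum up to e / 2 on a ball and the tail outside. *)
Let open_mass_sigma_subadditive (O : nat -> set E) : (forall i, open (O i)) ->
  (open_mass (\bigcup_i O i) <= \sum_(i <oo) open_mass (O i))%E.
Proof.
move=> oO; apply: open_mass_le => f [tf f0]; apply/lee_addgt0Pr => e e0.
have e20 : 0 < e / 2 by rewrite divr_gt0.
have [M M0 Mtail] := nu_tight e20.
pose F n x := f x - \sum_(i < n) lower_envelope (O i) n x.
have env_ge0 i n x : 0 <= lower_envelope (O i) n x.
  exact: unit_lipschitz_ge0 (lower_envelope_unit_lipschitz (O i) n).
have [n Fn] : exists n, forall x, `|x| <= M -> F n x < e / 2.
  apply: uniform_on_ball.
  - move=> n x; apply: cvgB.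
      by case: tf => L Lf; exact: (unit_lipschitz_continuous Lf).
    apply: cvg_big => [|i _]; first exact: add_continuous.
    exact: (unit_lipschitz_continuous (lower_envelope_unit_lipschitz _ _)).
  - move=> m n x mn; rewrite lerD2l lerN2.
    rewrite (big_ord_widen _ (fun i => lower_envelope (O i) m x) mn) big_mkcond; apply: ler_sum => i _; case: ifP => _ //.
    exact: lower_envelope_nondecreasing.
  - move=> x; have [[i _ Oix]|nOx] := pselect ((\bigcup_i O i) x); last first.
      by exists 0%N; rewrite /F f0// big_ord0 subr0.
    have [N _ N1] := lower_envelope_eq1 (oO i) Oix.
    exists (maxn N i.+1); rewrite /F.
    have im : (i < maxn N i.+1)%N by rewrite leq_max leqnn orbT.
    rewrite (bigD1 (Ordinal im))//= N1/=; last by rewrite leq_maxl.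
    rewrite (le_lt_trans _ e20)// opprD addrA.
    rewrite (@le_trans _ _ (f x - 1))//; last first.
      by case: tf => L Lf; have := unit_lipschitz_le1 x Lf; lra.
    by rewrite gerDl oppr_le0 sumr_ge0.
have ttail : test (tail M) by exists M^-1; exact: tail_unit_lipschitz.
have fle x : f x <= e / 2 + tail M x + \sum_(i < n) lower_envelope (O i) n x.
  have [xM|Mx] := leP `|x| M.
    rewrite -lerBlDr (le_trans (ltW (Fn _ xM)))// lerDl.
    by case: ttail => L Lt; exact: unit_lipschitz_ge0 Lt.
  rewrite (tail_eq1 M0 (ltW Mx)) (@le_trans _ _ 1)//.
    by case: tf => L Lf; exact: unit_lipschitz_le1 Lf.
  by rewrite [e / 2 + 1]addrC -addrA lerDl addr_ge0 ?(ltW e20)// sumr_ge0.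
have := Lam_le_sum (h := fun i => lower_envelope (O i) n) tf ttail
  (fun i => test_envelope (O i) n) fle.
have Ltail : Lam (tail M) <= e / 2.
  by apply: cvgr_to_le (LamP ttail) _; exact: nearW.
move=> Lfle.
have {}Lfle : Lam f <= \sum_(i < n) Lam (lower_envelope (O i) n) + e.
  by rewrite (le_trans Lfle)// addrC lerD2l [leRHS](splitr e) lerD2l.
rewrite (@le_trans _ _ (\sum_(i < n) Lam (lower_envelope (O i) n) + e)%:E)//.
rewrite EFinD leeD2r// -sumEFin.
rewrite (@le_trans _ _ (\sum_(i < n) open_mass (O i))%E)//.
  apply: lee_sum => i _; apply: Lam_le_open_mass; split; first exact: test_envelope.
  by move=> x; exact: lower_envelope_eq0.
rewrite -(big_mkord xpredT (open_mass \o O)).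
by apply: (@nneseries_lim_ge _ (open_mass \o O) xpredT 0%N n) => i _ _; exact: open_mass_ge0.
Qed.

Let outer_mass (A : set E) : \bar R :=
  ereal_inf [set open_mass G | G in [set G | open G /\ A `<=` G]].

Let outer_mass_le A G : open G -> A `<=` G -> (outer_mass A <= open_mass G)%E.
Proof. by move=> oG AG; apply: ereal_inf_lbound; exists G. Qed.

Let le_outer_mass_inf A c : (forall G, open G -> A `<=` G -> (c <= open_mass G)%E) ->
  (c <= outer_mass A)%E.
Proof. by move=> cA; apply: le_ereal_inf_tmp => _ [G [oG AG] <-]; exact: cA. Qed.

Let outer_mass_open O : open O -> outer_mass O = open_mass O.
Proof.
move=> oO; apply/eqP; rewrite eq_le outer_mass_le//=.
by apply: le_outer_mass_inf => G _; exact: le_open_mass.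
Qed.

Let outer_mass0 : outer_mass set0 = 0%E.
Proof.
rewrite outer_mass_open; last exact: open0.
apply/eqP; rewrite eq_le open_mass_ge0 andbT; apply: open_mass_le => f [_ f0].
rewrite lee_fin (_ : f = fun=> 0) ?Lam_cst//.
by apply/funext => x; exact: f0.
Qed.

Let outer_mass_ge0 A : (0 <= outer_mass A)%E.
Proof. by apply: le_outer_mass_inf => G _ _. Qed.

Let le_outer_mass : {homo outer_mass : A B / A `<=` B >-> (A <= B)%E}.
Proof.
move=> A B AB; apply: le_outer_mass_inf => G oG BG; apply: outer_mass_le => //.
exact: subset_trans BG.
Qed.

Let outer_mass_sigma_subadditive : sigma_subadditive outer_mass.
Proof.
move=> A; apply/lee_addgt0Pr => e e0.
apply: le_trans (epsilon_trick _ _ (ltW e0)); last by [].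
have [G PG] : {G : (set E)^nat & forall n, [/\ open (G n), A n `<=` G n &
    (open_mass (G n) <= outer_mass (A n) + (e / (2 ^ n.+1)%:R)%:E)%E]}.
  apply: (@choice _ _ (fun n G => [/\ open G, A n `<=` G &
    (open_mass G <= outer_mass (A n) + (e / (2 ^ n.+1)%:R)%:E)%E])) => n.
  have en0 : 0 < e / (2 ^ n.+1)%:R by rewrite divr_gt0// ltr0n expn_gt0.
  have fin : outer_mass (A n) \is a fin_num.
    rewrite ge0_fin_numE// (@le_lt_trans _ _ 1%E) ?ltry//.
    by rewrite (le_trans (@outer_mass_le _ setT _ _))//; exact: openT.
  have [_ [G [oG AG] <-] Gle] := lb_ereal_inf_adherent en0 fin.
  by exists G; split => //; exact: ltW.
rewrite (@le_trans _ _ (open_mass (\bigcup_n G n)))//.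
  apply: outer_mass_le; first by apply: bigcup_open => n _; case: (PG n).
  by apply: subset_bigcup => n _; case: (PG n).
rewrite (le_trans (open_mass_sigma_subadditive _))//.
  by move=> n; case: (PG n).
apply: lee_nneseries => // n _; by case: (PG n).
Qed.

HB.instance Definition _ := isOuterMeasure.Build R E outer_mass outer_mass0
  outer_mass_ge0 le_outer_mass outer_mass_sigma_subadditive.

(** Given f living on G `&` O, the truncation f1 of f - e and any g living on the
    open set W, where f < e, have disjoint supports: f1 + g is again a test
    function living on G.  As W contains G minus O, this gives superadditivity
    up to e. *)
Let outer_mass_caratheodory_open O : open O -> outer_mass.-caratheodory O.
Proof.
move=> oO; apply: (@le_caratheodory_measurable _ _ outer_mass) => A.
apply: le_outer_mass_inf => G oG AG.
rewrite (@le_trans _ _ (open_mass (G `&` O) + outer_mass (G `&` ~` O))%E)//.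
  by rewrite leeD ?outer_mass_le ?le_outer_mass//; [exact: openI|exact: setSI|exact: setSI].
have fin B : outer_mass B \is a fin_num.
  rewrite ge0_fin_numE// (@le_lt_trans _ _ 1%E) ?ltry//.
  by rewrite (le_trans (@outer_mass_le _ setT _ _))//; exact: openT.
rewrite -leeBrDr//; apply: open_mass_le => f [tf f0]; rewrite leeBrDr//.
apply/lee_addgt0Pr => e e0.
have [L Lf] := tf.
pose W := G `&` [set x | f x < e].
have oW : open W.
  apply: openI => //; rewrite (_ : [set x | _] = f @^-1` [set t | t < e]); last by [].
  by apply: open_comp; [move=> x _; exact: (unit_lipschitz_continuous Lf)|exact: open_lt].
pose f1 x := clip (f x - e).
have tf1 : test f1.
  exists L; apply: unit_lipschitz_clip => x y.
  by rewrite opprB addrA subrK; case: Lf.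
have ff1 x : f x <= e + f1 x.
  rewrite /f1 /clip; have := unit_lipschitz_le1 x Lf.
  by case: (leP (f x - e) 0) => ?; case: (leP 1 (f x - e)) => ?; lra.
rewrite (@le_trans _ _ ((Lam f)%:E + open_mass W)%E)//.
  rewrite leeD2l// outer_mass_le// => x [Gx Ox]; split => //=.
  by rewrite f0// => -[].
have Wfin : open_mass W \is a fin_num.
  by rewrite ge0_fin_numE// (le_lt_trans (open_mass_le1 W))// ltry.
rewrite addeC -leeBrDr//; apply: open_mass_le => g [tg g0]; rewrite leeBrDr//.
rewrite -EFinD (@le_trans _ _ (Lam f1 + Lam g + e)%:E)//.
  by rewrite lee_fin [leLHS]addrC addrAC lerD2r addrC Lam_le.
rewrite EFinD leeD2r//.
pose k x := f1 x + g x.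
have f1W x : f1 x != 0 -> ~ W x.
  apply: contra_neqP; rewrite notK => -[_ /= fxe].
  by rewrite /f1 /clip; case: (leP (f x - e) 0) => //; lra.
have k01 x : 0 <= k x <= 1.
  have /andP[f10 f11] := clip01 (f x - e).
  have [Lg Lgg] := tg; have := unit_lipschitz_ge0 x Lgg; have := unit_lipschitz_le1 x Lgg.
  rewrite /k; have [f1x|/f1W/g0 ->] := eqVneq (f1 x) 0; first by rewrite f1x; lra.
  by rewrite /f1; lra.
have tk : test k.
  have [L1 [_ L1f]] := tf1; have [L2 [_ L2g]] := tg.
  exists (L1 + L2); split=> // x y; rewrite /k opprD addrACA mulrDl.
  by rewrite (le_trans (ler_normD _ _))// lerD.
rewrite (@le_trans _ _ (Lam k)%:E)//.
  have := @sum_le_Lam k (fun i => if i == 0%N then f1 else g) 1 2 tk.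
  rewrite big_ord_recl big_ord1/= mul1r; apply => [[|]//|x].
  by rewrite big_ord_recl big_ord1/= mul1r.
apply: Lam_le_open_mass; split => // x Gx; rewrite /k.
rewrite g0; last by move=> [].
rewrite addr0 /f1 f0; last by move=> [].
by rewrite /clip sub0r oppr_le0 ltW.
Qed.

Let outer_mass_caratheodory (A : set (borel E)) : measurable A ->
  outer_mass.-cara.-measurable A.
Proof.
apply: smallest_sub; first exact:
  (@sigma_algebra_measurable _ (caratheodory_type outer_mass)).
by move=> O oO; exact: outer_mass_caratheodory_open.
Qed.

Let limit_measure (A : set (borel E)) : \bar R := outer_mass A.

Let limit_sigma_additive : semi_sigma_additive limit_measure.
Proof.
move=> F mF tF mUF.
apply: (@caratheodory_measure_sigma_additive _ _ outer_mass) => //.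
  by move=> i; exact: outer_mass_caratheodory.
exact: outer_mass_caratheodory.
Qed.

HB.instance Definition _ := isMeasure.Build _ (borel E) R limit_measure
  outer_mass0 outer_mass_ge0 limit_sigma_additive.

Let limit_setT : limit_measure setT = 1%E.
Proof. by rewrite /limit_measure outer_mass_open ?open_massT//; exact: openT. Qed.

HB.instance Definition _ :=
  Measure_isProbability.Build _ _ _ limit_measure limit_setT.

Let pi : probability (borel E) R := limit_measure.

(** The n slices of height 1 of n * f; they sum to n * f, and each slice is
    squeezed between the indicators of two consecutive level sets. *)
Let staircase (f : E -> R) (n i : nat) (x : E) : R := clip (n%:R * f x - i%:R).

Let test_staircase f n i : test f -> test (staircase f n i).
Proof.
move=> [L [f01 Lf]]; exists (n%:R * L); apply: unit_lipschitz_clip => x y.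
rewrite opprB addrA subrK -mulrBr normrM ger0_norm// -mulrA.
exact: ler_wpM2l.
Qed.

Let sum_staircase f n x : 0 <= f x <= 1 ->
  \sum_(i < n) staircase f n i x = n%:R * f x.
Proof.
move=> f01.
(* The sum of the first m slices is the minimum of n * f x and m. *)
have H m : \sum_(i < m) staircase f n i x =
    if n%:R * f x <= m%:R then n%:R * f x else m%:R.
  have nf0 : 0 <= n%:R * f x by apply: mulr_ge0 => //; case/andP: f01.
  elim: m => [|m ih].
    by rewrite big_ord0; case: leP => // ?; apply/eqP; rewrite eq_le; apply/andP.
  rewrite big_ord_recr/= ih /staircase /clip -natr1.
  move: (n%:R * f x) (m%:R : R) => t s.
  by case: (leP t s) => ?; case: (leP (t - s) 0) => ?; case: (leP 1 (t - s)) => ?;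
    case: (leP t (s + 1)) => ?; lra.
rewrite H ifT// -[leRHS]mulr1 ler_wpM2l//; by case/andP: f01.
Qed.

(** Slice i + 1 is at most the indicator of the level set n * f > i + 1, whose
    mass is at most Lam of slice i since slice i equals 1 there.  The shift by one
    slice costs 1 / n after division by n. *)
Let expect_limit_le f : test f -> \int[pi]_x f x <= Lam f.
Proof.
move=> tf; have [L Lf] := tf; have f01 := Lf.1.
have bs n i := test_bm (@test_staircase f n i tf).
apply/ler_addgt0Pl => e e0.
have [n n0 ne] : exists2 n, (0 < n)%N & (n%:R^-1 <= e :> R).
  have [n] := near_infty_natSinv_lt (PosNum e0); move=> _ /(_ n (leqnn n)) /= ne.
  by exists n.+1 => //; exact: ltW.
have n0R : 0 < n%:R :> R by rewrite ltr0n.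
suff H : n%:R * \int[pi]_x f x <= 1 + n%:R * Lam f.
  rewrite (@le_trans _ _ (n%:R^-1 + Lam f)) ?lerD2r//.
  rewrite -(ler_pM2l n0R) mulrDr mulfV//; exact: lt0r_neq0.
rewrite -expectZ; last exact: test_bm.
have -> : \int[pi]_x (n%:R * f x) = \int[pi]_x (\sum_(i < n) staircase f n i x).
  by apply: eq_Rintegral => x _; rewrite sum_staircase.
rewrite (@expect_sum _ _ _ pi _ (index_enum 'I_n) (fun i => staircase f n i))//.
case: n n0 n0R {ne} bs => // n _ n0R bs; rewrite big_ord_recl/= lerD//.
  have := expect_unit_lipschitz pi; have [L1 L1f] := @test_staircase f n.+1 0%N tf.
  by move=> /(_ _ _ L1f)/andP[].
rewrite (@le_trans _ _ (\sum_(i < n.+1) Lam (staircase f n.+1 i)))//; last first.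
  apply: sum_le_Lam => // [i|x]; first exact: test_staircase.
  by rewrite sum_staircase.
rewrite big_ord_recr/= -[leLHS]addr0 lerD//; last exact/Lam_ge0/test_staircase.
apply: ler_sum => i _; rewrite /bump add1n.
pose O := [set x : E | n.+1%:R * f x - i.+1%:R > 0].
have cO : continuous (fun x => n.+1%:R * f x - i.+1%:R).
  move=> x; apply: cvgB; last exact: cvg_cst.
  by apply: cvgM; [exact: cvg_cst|exact: (unit_lipschitz_continuous Lf)].
have oO : open O.
  rewrite (_ : O = (fun x => n.+1%:R * f x - i.+1%:R) @^-1` [set t | 0 < t]); last by [].
  by apply: open_comp; [move=> x _; exact: cO|exact: open_gt].
have mO := open_borel oO.
rewrite -lee_fin EFin_expect//.
rewrite (@le_trans _ _ (\int[pi]_x (\1_O x)%:E)%E)//.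
  apply: ge0_le_integral => //.
  - by move=> x _; rewrite lee_fin; case/andP: (clip01 (n.+1%:R * f x - i.+1%:R)).
  - by apply/measurable_EFinP; have [] := bs n.+1 i.+1.
  - by apply/measurable_EFinP; exact: measurable_indic.
  move=> x _; rewrite lee_fin indicE /staircase /clip.
  have [Ox|Ox] := pselect (O x).
    by rewrite mem_set//=; case: (leP _ 0) => // ?; case: (leP 1 _) => // /ltW.
  by rewrite memNset//= ifT// leNgt; exact/negP.
rewrite integral_indic// setIT [leLHS]outer_mass_open//.
apply: open_mass_le => g [tg g0]; rewrite lee_fin -[leRHS]add0r.
apply: Lam_le => //; first exact: test_staircase.
move=> x; rewrite add0r; have [Lg Lgg] := tg; have g1 := unit_lipschitz_le1 x Lgg.
have [Ox|Ox] := pselect (O x); last first.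
  by rewrite g0//; case/andP: (clip01 (n.+1%:R * f x - i%:R)).
rewrite (le_trans g1)// /staircase /clip; move: Ox; rewrite /O/=.
move: (n.+1%:R * f x) => t; rewrite -natr1 => Ox.
by case: (leP (t - i%:R) 0) => ?; case: (leP 1 (t - i%:R)) => ?; lra.
Qed.

(** The inequality of expect_limit_le for f and for 1 - f gives the equality,
    because both sides have total mass 1. *)
Lemma tight_weak_limit : exists pi : probability (borel E) R,
  forall L (f : E -> R), unit_lipschitz L f ->
    \int[nu k]_x f x @[k --> \oo] --> \int[pi]_x f x.
Proof.
exists pi => L f Lf; have tf : test f by exists L.
suff -> : \int[pi]_x f x = Lam f by exact: LamP.
apply/eqP; rewrite eq_le expect_limit_le//=.
have tf' : test (fun x => 1 - f x) by exists L; exact: unit_lipschitzC.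
have bf := test_bm tf; have := expect_limit_le tf'; rewrite expectB// expect_cst.
have : Lam (fun x => 1 - f x) + Lam f <= 1.
  have := @sum_le_Lam (fun=> 1) (fun i => if i == 0%N then (fun x => 1 - f x) else f) 1 2.
  rewrite big_ord_recl big_ord1/= Lam_cst mulr1; apply.
  - by apply: test_cst; rewrite lexx ler01.
  - by case.
  - by move=> x; rewrite big_ord_recl big_ord1/= subrK ?mulr1 ?mul1r.
lra.
Qed.

End weak_limit.

(** * Prokhorov convergence *)

Section prokhorov_convergence.
Context (R : realType) (E : euclideanType R).
Implicit Types (nu pi : probability (borel E) R).

Lemma open_thickening (A : set E) (e : R) : open (thickening A e).
Proof.
apply: bigcup_open => x _.
by rewrite (_ : [set y | _] = ball x e); [exact: ball_open|rewrite -ball_normE].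
Qed.

Lemma thickening_complement (A : set E) (e : R) :
  thickening (~` thickening A e) e `<=` ~` A.
Proof. by move=> y [x + /= xy] Ay; apply; exists y => //=; rewrite distrC. Qed.

(** For probabilities the two inequalities defining the Prokhorov distance are
    equivalent: apply one to the complement of a thickening. *)
Lemma thickening_swap nu pi (e : R) :
    (forall A : set (borel E), measurable A ->
      (pi A <= nu (thickening A e) + e%:E)%E) ->
  forall A : set (borel E), measurable A -> (nu A <= pi (thickening A e) + e%:E)%E.
Proof.
move=> pinu A mA.
have mT (B : set E) : measurable (thickening B e : set (borel E)).
  by apply: open_borel; exact: open_thickening.
have := pinu (~` thickening A e) (measurableC (mT A)).
rewrite probability_setC; last exact: mT.
have : (nu (thickening (~` thickening A e) e) <= 1 - nu A)%E.
  rewrite -probability_setC//; apply: le_measure.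
  - rewrite inE; exact: mT.
  - rewrite inE; exact: measurableC.
  - exact: thickening_complement.
rewrite -[nu A]fineK ?fin_num_measure// -[pi (thickening A e)]fineK ?fin_num_measure//.
rewrite -[nu (thickening _ _)]fineK ?fin_num_measure//.
rewrite -!EFinB -!EFinD !lee_fin.
set a := fine _; set b := fine _; set c := fine _; lra.
Qed.

(** Cover most of the mass of pi by finitely many balls of radius e / 2.  Lower
    semicontinuity on open sets holds simultaneously for the finitely many unions
    of these balls, and a set A is controlled by the union of those that
    meet it, a union that lies in the e-thickening of A. *)
Lemma weak_prokhorov (nu : nat -> probability (borel E) R) pi :
  (forall L (f : E -> R), unit_lipschitz L f ->
    \int[nu k]_x f x @[k --> \oo] --> \int[pi]_x f x) ->
  prokhorov_cvg nu pi.
Proof.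
move=> nupi; apply/cvgrPdist_le => e e0.
suff key : \forall k \near \oo, forall A : set (borel E), measurable A ->
    (pi A <= nu k (thickening A e) + e%:E)%E.
  apply: filterS key => k key.
  rewrite sub0r normrN /prokhorov; set S := (X in inf X); have Se : S e.
    by split => // A mA; split; [exact: thickening_swap|exact: key].
  have S0 : lbound S 0 by move=> x [/ltW].
  rewrite ger0_norm; last by apply: lb_le_inf => //; exists e.
  by apply: ge_inf => //; exists 0.
have e40 : 0 < e / 4 by rewrite divr_gt0.
have e20 : 0 < e / 2 by rewrite divr_gt0.
have [N _ /(_ _ (leqnn N)) piN] := tail_small pi e40.
have [s sN] := @finite_net R E N.+1%:R _ e20.
pose O (J : {set 'I_(size s)}) : set E :=
  \bigcup_(i in [set i | i \in J]) ball (s`_i : E) (e / 2).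
have oO J : open (O J) by apply: bigcup_open => i _; exact: ball_open.
have mO J := open_borel (oO J).
have nuO : \forall k \near \oo, forall J, fine (pi (O J)) <= fine (nu k (O J)) + e / 2.
  apply: filter_forall => J.
  have /cvgrPdist_lt/(_ _ e40)[n _ /(_ _ (leqnn n))/= piJ] :=
    @expect_lower_envelope_cvg _ _ pi _ (oO J).
  have Ln := lower_envelope_unit_lipschitz (O J) n.
  have /cvgrPdist_lt/(_ _ e40) := nupi _ _ Ln.
  apply: filterS => k nuk.
  have : \int[nu k]_x lower_envelope (O J) n x <= fine (nu k (O J)).
    have -> : fine (nu k (O J)) = \int[nu k]_x \1_(O J) x.
      by rewrite /Rintegral integral_indic ?setIT.
    apply: le_expect.
    - exact: unit_lipschitz_bounded_measurable Ln.
    - split; first exact: measurable_indic.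
      by exists 1 => x; rewrite indicE ger0_norm// lern1 leq_b1.
    - by move=> x; exact: lower_envelope_le_indic.
  move: nuk piJ; rewrite !ltr_norml => /andP[? ?] /andP[? ?]; lra.
apply: filterS nuO => k nuO A mA.
pose J := [set i : 'I_(size s) | `[< exists2 x, A x & ball (s`_i : E) (e / 2) x >]]%SET.
have AO x : A x -> `|x| <= N.+1%:R -> O J x.
  move=> Ax /sN[y ys xy]; have ys' : (index y s < size s)%N by rewrite index_mem.
  have bx : ball (s`_(Ordinal ys') : E) (e / 2) x.
    by rewrite /= nth_index// -ball_normE/= distrC.
  by exists (Ordinal ys') => //=; rewrite inE; apply/asboolP; exists x.
have OT : O J `<=` thickening A e.
  move=> y [i /=]; rewrite inE => /asboolP[x Ax].
  rewrite -ball_normE/= => ix iy; exists x => //=.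
  rewrite (le_lt_trans (ler_distD (s`_i) _ _))// [ltRHS]splitr ltrD//.
  by rewrite distrC.
have mT : measurable (thickening A e : set (borel E)).
  by apply: open_borel; exact: open_thickening.
have Lt := @tail_unit_lipschitz R E N.+1%:R (ltr0Sn _ _).
have piA : fine (pi A) <= fine (pi (O J)) + e / 4.
  have ind (B : set (borel E)) : measurable B ->
      bounded_measurable (\1_B : borel E -> R).
    split; first exact: measurable_indic.
    by exists 1 => x; rewrite indicE ger0_norm// lern1 leq_b1.
  have fineE (B : set (borel E)) : measurable B -> fine (pi B) = \int[pi]_x \1_B x.
    by move=> mB; rewrite /Rintegral integral_indic ?setIT.
  rewrite !fineE//.
  rewrite (@le_trans _ _ (\int[pi]_x (\1_(O J) x + tail N.+1%:R x)))//.
    apply: le_expect; first exact: ind.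
      apply: bounded_measurableD; first exact: (ind _ (mO J)).
      exact: unit_lipschitz_bounded_measurable Lt.
    move=> x; rewrite [leLHS]indicE; have [Ax|Ax] := pselect (A x); last first.
      by rewrite memNset// addr_ge0 ?indicE ?ler0n// (unit_lipschitz_ge0 _ Lt).
    rewrite mem_set//; have [xN|/ltW Nx] := leP `|x| N.+1%:R.
      by rewrite indicE mem_set ?lerDl ?(unit_lipschitz_ge0 _ Lt)//; exact: AO.
    by rewrite tail_eq1 ?lerDr ?indicE ?ler0n.
  rewrite expectD; [|exact: (ind _ (mO J))|exact: unit_lipschitz_bounded_measurable Lt].
  by rewrite lerD2l.
rewrite -[pi A]fineK ?fin_num_measure//.
rewrite (@le_trans _ _ (nu k (O J) + e%:E)%E)//; last first.
  by rewrite leeD2r// le_measure// inE//.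
rewrite -[nu k (O J)]fineK ?fin_num_measure//.
rewrite -EFinD lee_fin (le_trans piA)//; have := nuO J; lra.
Qed.

End prokhorov_convergence.

(** * Mixtures of probabilities *)

Section mixture.
Context d1 d2 (T1 : measurableType d1) (T2 : measurableType d2) (R : realType).
Variables (mu : probability T1 R) (K : T1 -> probability T2 R).
Hypothesis mK : forall A, measurable A -> measurable_fun setT (fun x => K x A).

Let k (x : T1) : giry T2 R := K x.

Let mk : measurable_fun setT k.
Proof. exact: measurable_giry_codensity. Qed.

Lemma expect_mixture (M : probability T2 R) (f : T2 -> R) :
  (forall A, measurable A -> M A = \int[mu]_x K x A)%E ->
  bounded_measurable f -> (forall y, 0 <= f y) ->
  \int[M]_y f y = \int[mu]_x \int[K x]_y f y.
Proof.
move=> ME bf f0; rewrite /Rintegral; congr fine.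
have mf : measurable_fun setT (EFin \o f) by apply/measurable_EFinP; case: bf.
have f0' y : (0 <= (EFin \o f) y)%E by rewrite lee_fin.
transitivity (giry_int (giry_bind (mu : giry T1 R) mk) (EFin \o f)).
  apply: eq_measure_integral => A mA _; rewrite [LHS]ME//.
  rewrite /giry_bind/= /giry_join/=.
  rewrite giry_int_map//.
  exact: measurable_giry_ev.
rewrite giry_int_bind//; apply: eq_integral => x _.
by rewrite [RHS]EFin_expect.
Qed.

(** The bind of the Giry monad provides the mixture as a sub-probability. *)
Lemma mixture_exists :
  exists M : probability T2 R, forall A, measurable A -> M A = (\int[mu]_x K x A)%E.
Proof.
have ME A : measurable A -> giry_bind (mu : giry T1 R) mk A = (\int[mu]_x K x A)%E.
  move=> mA; rewrite /giry_bind/= /giry_join/= giry_int_map//.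
  exact: measurable_giry_ev.
have MT : giry_bind (mu : giry T1 R) mk setT = 1%E.
  rewrite ME//; under eq_integral do rewrite probability_setT.
  by rewrite integral_cst// mul1e; exact: probability_setT.
pose M := Measure_isProbability.Build _ _ _ (giry_bind (mu : giry T1 R) mk) MT.
by exists (HB.pack_for (probability T2 R) (Measure.sort (giry_bind (mu : giry T1 R) mk)) M).
Qed.

End mixture.

Section measurable_limit.
Context (R : realType) (E : euclideanType R).

(** Open sets are handled by approximation from below, and the general case by
    the pi-lambda theorem. *)
Lemma measurable_kernel_weak (K : E -> probability (borel E) R) :
  (forall L (f : E -> R), unit_lipschitz L f ->
    measurable_fun [set: borel E] (fun x => \int[K x]_y f y)) ->
  forall A : set (borel E), measurable A ->
    measurable_fun [set: borel E] (fun x => K x A).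
Proof.
move=> mK; apply: (@dynkin_induction _ (borel E) (@open E)) => //.
- exact: openI.
- rewrite (_ : (fun x => _) = cst 1%E); first exact: measurable_cst.
  by apply/funext => x; exact: probability_setT.
- move=> O oO.
  rewrite (_ : (fun x => _) = fun x => (fine (K x O))%:E); last first.
    by apply/funext => x; rewrite fineK// fin_num_measure//; exact: open_borel.
  apply/measurable_EFinP.
  apply: (@measurable_fun_cvg _ (borel E) R _
    (fun n x => \int[K x]_y lower_envelope O n y)).
    by move=> n; apply: mK; exact: lower_envelope_unit_lipschitz.
  by move=> x _; exact: (@expect_lower_envelope_cvg R E (K x) O oO).
- move=> S mS KS; under eq_fun do rewrite probability_setC//.
  exact: emeasurable_funB.
- move=> F mF tF KF.
  apply: (@emeasurable_fun_cvg _ (borel E) R _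
    (fun n x => \sum_(0 <= i < n) K x (F i))%E).
    by move=> n; apply: emeasurable_sum.
  by move=> x _; exact: measure_sigma_additive.
Qed.

End measurable_limit.

(** * The Markov operator on functions *)

Section markov_operator.
Context (R : realType) (E : euclideanType R) (dO dI : measure_display)
  (Omega : measurableType dO) (I : measurableType dI).
Variables (P : probability Omega R) (xi : {RV P >-> I})
  (T : {mfun (borel E * I)%type >-> borel E}).
Implicit Types (f : E -> R) (nu : probability (borel E) R) (x : E) (L : R).

Definition markov_fun f x : R := \int[transition xi T x]_y f y.

(** The average of k + 1 iterates starting from the first one, so as to match
    cesaro_mean. *)
Definition cesaro_fun k f x : R :=
  k.+1%:R^-1 * \sum_(i < k.+1) iter i.+1 markov_fun f x.

Lemma markov_funE f x : bounded_measurable (f : borel E -> R) ->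
  (forall y, 0 <= f y) -> markov_fun f x = \int[P]_w f (T (x, xi w)).
Proof.
move=> bf f0; have mf : measurable_fun setT (EFin \o (f : borel E -> R)).
  by apply/measurable_EFinP; case: bf.
rewrite /markov_fun /Rintegral; congr fine.
have mx : measurable_fun setT (fun w => T (x, xi w) : borel E).
  have mp : measurable_fun setT (fun w => ((x : borel E), xi w)).
    by apply: measurable_fun_pair.
  exact: measurableT_comp mp.
transitivity (\int[pushforward P (fun w => T (x, xi w) : borel E)]_y (f y)%:E)%E.
  exact: eq_measure_integral.
rewrite ge0_integral_pushforward//.
by move=> y _; rewrite lee_fin.
Qed.

Hypothesis nonexp : forall i : I, nonexpansive (fun x : E => T (x, i)).

(** Two copies of the chain driven by the same noise do not move apart. *)
Lemma markov_fun_unit_lipschitz L f : unit_lipschitz L f ->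
  unit_lipschitz L (markov_fun f).
Proof.
move=> Lf; split => [x|x y]; first exact: expect_unit_lipschitz Lf.
have bf := unit_lipschitz_bounded_measurable Lf.
have f0 z : 0 <= f z by exact: unit_lipschitz_ge0 Lf.
rewrite !markov_funE//.
have bT z : bounded_measurable (fun w => f (T (z, xi w))).
  split; last by have [_ [C fC]] := bf; exists C => w.
  have mp : measurable_fun setT (fun w => ((z : borel E), xi w)).
    by apply: measurable_fun_pair.
  apply: (measurableT_comp bf.1).
  exact: measurableT_comp mp.
rewrite -expectB// -(expect_cst P (L * `|x - y|)).
apply: norm_expect_le => [|//|w]; first exact: bounded_measurableB.
rewrite (le_trans (Lf.2 _ _))//; have Txy := nonexp (xi w) x y.
(* A test function may be L-Lipschitz with L < 0 only if E is a point. *)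
have [L0|L0] := leP 0 L; first exact: ler_wpM2l.
have xy0 : `|x - y| <= 0.
  by rewrite -(ler_nM2l L0) mulr0 (le_trans _ (Lf.2 x y)).
rewrite ler_nM2l// (le_trans xy0)//.
Qed.

Lemma iter_markov_fun_unit_lipschitz L f j : unit_lipschitz L f ->
  unit_lipschitz L (iter j markov_fun f).
Proof. by move=> Lf; elim: j => // j; exact: markov_fun_unit_lipschitz. Qed.

Let iter_bm L f j : unit_lipschitz L f ->
  bounded_measurable (iter j markov_fun f : borel E -> R).
Proof.
by move=> /(iter_markov_fun_unit_lipschitz j); exact: unit_lipschitz_bounded_measurable.
Qed.

Lemma cesaro_fun_unit_lipschitz L f k : unit_lipschitz L f ->
  unit_lipschitz L (cesaro_fun k f).
Proof.
move=> Lf; have Lj j := iter_markov_fun_unit_lipschitz j Lf.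
have k0 : 0 < k.+1%:R :> R by rewrite ltr0n.
split => [x|x y]; rewrite /cesaro_fun.
  apply/andP; split.
    by rewrite mulr_ge0// sumr_ge0// => i _; exact: unit_lipschitz_ge0 (Lj i.+1).
  rewrite -ler_pdivlMl// invrK mulr1.
  rewrite -[X in _ <= X%:R]card_ord -sum1_card natr_sum.
  by apply: ler_sum => i _; exact: unit_lipschitz_le1 (Lj i.+1).
rewrite -mulrBr -sumrB normrM ger0_norm ?invr_ge0//.
rewrite -ler_pdivlMl// invrK mulr_natl.
rewrite (le_trans (ler_norm_sum _ _ _))// -[X in _ <= _ *+ X]card_ord -sumr_const.
by apply: ler_sum => i _; case: (Lj i.+1).
Qed.

Lemma expect_markov_op nu L f : unit_lipschitz L f ->
  \int[markov_op xi T nu]_y f y = \int[nu]_x markov_fun f x.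
Proof.
move=> Lf; apply: (@expect_mixture _ _ _ _ _ nu (fun x => transition xi T x)) => //.
- exact: measurable_transition.
- exact: unit_lipschitz_bounded_measurable Lf.
- by move=> y; exact: unit_lipschitz_ge0 Lf.
Qed.

Lemma expect_markov_iter nu L f j : unit_lipschitz L f ->
  \int[markov_iter xi T nu j]_y f y = \int[nu]_x iter j markov_fun f x.
Proof.
elim: j f => // j ih f Lf; rewrite /markov_iter iterS (expect_markov_op _ Lf).
rewrite [LHS]ih; last exact: markov_fun_unit_lipschitz.
by apply: eq_Rintegral => x _; rewrite -iterSr.
Qed.

Lemma expect_cesaro nu L f k : unit_lipschitz L f ->
  \int[cesaro_mean xi T nu k]_y f y = \int[nu]_x cesaro_fun k f x.
Proof.
move=> Lf; have bf := unit_lipschitz_bounded_measurable Lf.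
have f0 y : (0 <= (f y)%:E)%E by rewrite lee_fin; exact: unit_lipschitz_ge0 Lf.
have mf : measurable_fun setT (fun y : borel E => (f y)%:E).
  by apply/measurable_EFinP; case: bf.
rewrite expectZ; last first.
  by apply: (@bounded_measurable_sum _ (borel E) R _ (index_enum 'I_k.+1)
    (fun i => iter i.+1 markov_fun f)) => i; exact: iter_bm Lf.
rewrite (@expect_sum _ (borel E) R nu _ (index_enum 'I_k.+1)
  (fun i => iter i.+1 markov_fun f)); last by move=> i; exact: iter_bm Lf.
apply: EFin_inj; rewrite EFin_expect// EFinM -sumEFin.
transitivity (\int[mscale ((k.+1%:R^-1)%:nng)%R
    (msum (fun j => markov_iter xi T nu j.+1) k.+1)]_y (f y)%:E)%E.
  apply: eq_measure_integral => A _ _.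
  rewrite /= /cesaro_mean /mscale /= /msum; congr (_ * _)%E.
  by rewrite big_add1 big_mkord.
rewrite ge0_integral_mscale// ge0_integral_measure_sum//; congr (_ * _)%E.
apply: eq_bigr => i _; rewrite -EFin_expect// -(expect_markov_iter _ _ Lf)//.
Qed.

Lemma expect_dirac L f x : unit_lipschitz L f ->
  \int[(\d_(x : borel E) : probability (borel E) R)]_y f y = f x.
Proof.
move=> Lf; have [mf _] := unit_lipschitz_bounded_measurable Lf.
by rewrite /Rintegral integral_dirac ?diracT ?mul1e//; exact/measurable_EFinP.
Qed.

Let iter_cesaro_fun L f i m x : unit_lipschitz L f ->
  iter i markov_fun (cesaro_fun m f) x =
  m.+1%:R^-1 * \sum_(j < m.+1) iter (i + j.+1) markov_fun f x.
Proof.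
move=> Lf; elim: i x => //= i ih x.
have -> : iter i markov_fun (cesaro_fun m f) =
    fun x => m.+1%:R^-1 * \sum_(j < m.+1) iter (i + j.+1) markov_fun f x.
  exact/funext.
rewrite /markov_fun expectZ; last first.
  by apply: (@bounded_measurable_sum _ (borel E) R _ (index_enum 'I_m.+1)
    (fun j => iter (i + j.+1) markov_fun f)) => j; exact: iter_bm Lf.
rewrite (@expect_sum _ (borel E) R _ _ (index_enum 'I_m.+1)
  (fun j => iter (i + j.+1) markov_fun f))// => j; exact: iter_bm Lf.
Qed.

Lemma cesaro_funC L f k m x : unit_lipschitz L f ->
  cesaro_fun k (cesaro_fun m f) x = cesaro_fun m (cesaro_fun k f) x.
Proof.
move=> Lf; rewrite {1}/cesaro_fun [RHS]/cesaro_fun.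
under eq_bigr do rewrite (iter_cesaro_fun _ _ _ Lf).
under [in RHS]eq_bigr do rewrite (iter_cesaro_fun _ _ _ Lf).
rewrite -!mulr_sumr mulrCA exchange_big; congr (_ * (_ * _)).
by apply: eq_bigr => i _; apply: eq_bigr => j _; rewrite addnC.
Qed.

(** One application of the operator shifts the average by one index, which
    changes it by two boundary terms only. *)
Lemma cesaro_fun_iter L f k j x : unit_lipschitz L f ->
  `|cesaro_fun k (iter j markov_fun f) x - cesaro_fun k f x| <= j%:R / k.+1%:R.
Proof.
move=> Lf; elim: j => [|j ih]; first by rewrite subrr normr0 mul0r.
rewrite -natr1 mulrDl (le_trans (ler_distD (cesaro_fun k (iter j markov_fun f) x) _ _))//.
rewrite addrC lerD// /cesaro_fun -mulrBr -sumrB normrM ger0_norm ?invr_ge0//.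
rewrite mulrC ler_wpM2r ?invr_ge0//.
have Lj i := iter_markov_fun_unit_lipschitz i Lf.
rewrite (_ : \sum_(i < _) _ =
    \sum_(0 <= i < k.+1) (iter (i.+1 + j).+1 markov_fun f x - iter (i + j).+1 markov_fun f x)).
  rewrite (telescope_sumr (fun i => iter (i + j).+1 markov_fun f x))//.
  have /andP[? ?] := (Lj (k.+1 + j).+1).1 x; have /andP[? ?] := (Lj (0 + j).+1).1 x.
  rewrite ler_norml; lra.
rewrite big_mkord; apply: eq_bigr => i _.
by rewrite -!iterD !addSn addnS.
Qed.

Lemma cesaro_fun_cesaro_fun L f k m x : unit_lipschitz L f ->
  `|cesaro_fun k (cesaro_fun m f) x - cesaro_fun k f x| <= m.+1%:R / k.+1%:R.
Proof.
move=> Lf; have m0 : 0 < m.+1%:R :> R by rewrite ltr0n.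
have -> : cesaro_fun k (cesaro_fun m f) x =
    m.+1%:R^-1 * \sum_(j < m.+1) cesaro_fun k (iter j.+1 markov_fun f) x.
  rewrite {1}/cesaro_fun; under eq_bigr do rewrite (iter_cesaro_fun _ _ _ Lf).
  rewrite /cesaro_fun -!mulr_sumr mulrCA exchange_big; congr (_ * (_ * _)).
  by apply: eq_bigr => j _; apply: eq_bigr => i _; rewrite -iterD.
rewrite (_ : _ - _ = m.+1%:R^-1 *
    \sum_(j < m.+1) (cesaro_fun k (iter j.+1 markov_fun f) x - cesaro_fun k f x)); last first.
  rewrite sumrB mulrBr; congr (_ - _).
  by rewrite sumr_const card_ord -[X in _ * X]mulr_natl mulrA mulVf ?mul1r// gt_eqF.
rewrite normrM ger0_norm ?invr_ge0// -ler_pdivlMl// invrK.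
rewrite (le_trans (ler_norm_sum _ _ _))// [leRHS]mulr_natl.
rewrite -[X in _ <= _ *+ X]card_ord -sumr_const.
apply: ler_sum => j _; rewrite (le_trans (cesaro_fun_iter _ _ _ Lf))//.
by rewrite ler_wpM2r ?invr_ge0// ler_nat.
Qed.

End markov_operator.

(** * The support of a probability *)

Section support.
Context (R : realType) (E : euclideanType R) (mu : probability (borel E) R).

Lemma measurable_supp : measurable (supp mu : set (borel E)).
Proof.
rewrite -[supp mu]setCK; apply: measurableC; apply: open_borel.
by apply: closed_openC; apply: closed_bigI => C [].
Qed.

(** A point outside the support has a null neighbourhood, hence lies in a null
    ball taken from the countable family of the balls of radius 1 / (j + 1)
    centred at a 1 / (j + 1)-net of the ball of radius j + 1. *)
Lemma supp_complement_null : mu (~` supp mu) = 0%E.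
Proof.
have d0 j : 0 < j.+1%:R^-1 :> R by rewrite invr_gt0.
have /choice[s sP] : forall j, exists s : seq E, forall x : E, `|x| <= j.+1%:R ->
    exists2 y, y \in s & `|x - y| < j.+1%:R^-1.
  by move=> j; exact: finite_net.
pose B j i := ball ((s j)`_i : E) j.+1%:R^-1.
pose N j i := if mu (B j i) == 0%E then B j i else set0.
have mB j i : measurable (B j i : set (borel E)) by apply: open_borel; exact: ball_open.
apply: measure_negligible; first by apply: measurableC; exact: measurable_supp.
apply: (@negligibleS _ (borel E) R mu (\bigcup_j \bigcup_i N j i)); last first.
  apply: negligible_bigcup => j; apply: negligible_bigcup => i; rewrite /N.
  case: ifPn => [/eqP B0|_]; last exact: negligible_set0.
  by apply/negligibleP.
move=> x; rewrite /supp setC_bigcap => -[C [cC C1] Cx].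
have /nbhs_ballP[r/= r0 rC] := open_nbhs_nbhs (conj (closed_openC cC) Cx).
have mC : measurable (C : set (borel E)).
  by rewrite -[C]setCK; apply: measurableC; apply: open_borel; exact: closed_openC.
have [j xj jr] : exists2 j, `|x| <= j.+1%:R & j.+1%:R^-1 <= r / 2.
  have r2 : 0 < r / 2 by rewrite divr_gt0.
  have [n _ nr] := near_infty_natSinv_lt (PosNum r2).
  have [m _ mx] := nbhs_infty_ger `|x|.
  exists (maxn n m); last by apply/ltW/nr; rewrite /= leq_maxl.
  rewrite (le_trans (mx (maxn n m) _)) ?ler_nat//=; exact: leq_maxr.
have [y ys xy] := sP j x xj.
exists j => //; exists (index y (s j)) => //.
have Bx : B j (index y (s j)) x.
  by rewrite /B nth_index// -ball_normE/= distrC.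
rewrite /N; case: ifPn => // /negP; apply: contra_notP => _.
apply/eqP/negligibleP; first exact: mB.
apply: (@negligibleS _ (borel E) R mu (~` C)).
  move=> z; rewrite /B nth_index// -ball_normE/= => yz; apply: rC.
  rewrite -ball_normE/= (le_lt_trans (ler_distD y _ _))// [ltRHS]splitr ltrD//.
    exact: lt_le_trans jr.
  exact: lt_le_trans jr.
apply/negligibleP; first exact: measurableC.
by rewrite [LHS](probability_setC mu mC) C1 subee.
Qed.

End support.

(** * Ergodic averages *)

Section equicontinuity.
Context (R : realType) (E : euclideanType R).

(** Pigeonhole on the values of F m at a finite net, rounded down to multiples of
    1 / K: two functions with the same rounded values are close on the ball. *)
Lemma unit_lipschitz_subsequence (F : nat -> E -> R) (L M e : R) : 0 < e ->
  (forall m, unit_lipschitz L (F m)) ->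
  exists m, forall N, exists2 m', (N <= m')%N &
    forall x, `|x| <= M -> `|F m x - F m' x| <= e.
Proof.
move=> e0 LF; pose L' := `|L| + 1.
have L'0 : 0 < L' by rewrite ltr_pwDr.
have d0 : 0 < e / (4 * L') by rewrite divr_gt0// mulr_gt0.
have [s sM] := @finite_net R E M _ d0.
have e40 : 0 < e / 4 by rewrite divr_gt0.
have [K' _ /(_ _ (leqnn K'))/= K'e] := near_infty_natSinv_lt (PosNum e40).
pose K := K'.+1.
have K0 : 0 < K%:R :> R by rewrite ltr0n.
pose c m := [ffun i : 'I_(size s) =>
  inord (Num.truncn (K%:R * F m s`_i)) : 'I_K.+1].
have [a ca] : exists a, forall N, exists2 m, (N <= m)%N & c m = a.
  apply: contrapT => /forallNP H.
  have : \forall m \near \oo, forall a, c m <> a.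
    apply: filter_forall => a; have /existsNP[N NP] := H a.
    by exists N => // m /= Nm cma; apply: NP; exists m.
  by move=> [N _ /(_ N (leqnn N) (c N))].
have [m _ cm] := ca 0%N; exists m => N.
have [m' Nm' cm'] := ca N; exists m' => // x /sM[y ys xy].
have ys' : (index y s < size s)%N by rewrite index_mem.
have tr n : (Num.truncn (K%:R * F n y) < K.+1)%N.
  have /andP[f0 f1] := (LF n).1 y.
  have /truncn_itv/andP[+ _] : 0 <= K%:R * F n y by rewrite mulr_ge0.
  move=> h; rewrite ltnS -(ler_nat R) (le_trans h)// -[leRHS]mulr1.
  by rewrite ler_wpM2l.
have cE : Num.truncn (K%:R * F m y) = Num.truncn (K%:R * F m' y).
  have := congr1 (fun g : {ffun _ -> _} => val (g (Ordinal ys'))) (etrans cm (esym cm')).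
  by rewrite !ffunE/= nth_index// !inordK.
have yy : `|F m y - F m' y| <= e / 4.
  rewrite (le_trans _ (ltW K'e))// -[leRHS]mul1r ler_pdivlMr//.
  rewrite -[X in _ * X]gtr0_norm// -normrM mulrBl.
  have /andP[f0 _] := (LF m).1 y; have /andP[f0' _] := (LF m').1 y.
  have /truncn_itv : 0 <= K%:R * F m y by rewrite mulr_ge0.
  have /truncn_itv : 0 <= K%:R * F m' y by rewrite mulr_ge0.
  rewrite -cE -natr1 [K%:R * F m y]mulrC [K%:R * F m' y]mulrC ler_norml.
  move: (_ * _) (_ * _) => u v.
  lra.
have Lxy n : `|F n x - F n y| <= e / 4.
  rewrite (le_trans ((LF n).2 _ _))// (@le_trans _ _ (L' * `|x - y|))//.
    by rewrite ler_wpM2r// /L' (le_trans (ler_norm _))// lerDl.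
  rewrite mulrC -ler_pdivlMr// (le_trans (ltW xy))// invfM mulrA//.
have := Lxy m; have := Lxy m'; rewrite !ler_norml in yy *; lra.
Qed.

End equicontinuity.

Section ergodic.
Context (R : realType) (E : euclideanType R) (dO dI : measure_display)
  (Omega : measurableType dO) (I : measurableType dI).
Variables (P : probability Omega R) (xi : {RV P >-> I})
  (T : {mfun (borel E * I)%type >-> borel E}).
Hypothesis nonexp : forall i : I, nonexpansive (fun x : E => T (x, i)).
Variable pi0 : probability (borel E) R.
Hypothesis pi0_inv : invariant_probability xi T pi0.

Local Notation Pf := (markov_fun xi T).
Local Notation avg := (cesaro_fun xi T).

Let expect_invariant L (f : E -> R) j : unit_lipschitz L f ->
  \int[pi0]_x iter j Pf f x = \int[pi0]_x f x.
Proof.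
elim: j f => // j ih f Lf.
under eq_Rintegral do rewrite iterSr.
rewrite ih; last exact: (markov_fun_unit_lipschitz xi nonexp Lf).
rewrite -(expect_markov_op xi T pi0 Lf).
by rewrite /Rintegral; congr fine; apply: eq_measure_integral => A mA _; exact: pi0_inv.
Qed.

(** Integrate over y, against pi0, the Lipschitz estimate between x and y for
    the j-th iterate; the distance term min (1, |x - y| / M) is at most
    |x| / M + tail M y. *)
Let iter_tail_le M j (x : E) : 0 < M ->
  iter j Pf (tail M) x <= `|x| / M + 2 * \int[pi0]_y tail M y.
Proof.
move=> M0; have Lt := @tail_unit_lipschitz R E M M0.
have Lj := iter_markov_fun_unit_lipschitz xi nonexp j Lt.
have bt := unit_lipschitz_bounded_measurable Lt.
have bj := unit_lipschitz_bounded_measurable Lj.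
rewrite -[leLHS](expect_cst pi0).
rewrite (@le_trans _ _ (\int[pi0]_y (`|x| / M + (iter j Pf (tail M) y + tail M y))))//.
  apply: le_expect => //.
    by apply: bounded_measurableD => //; exact: bounded_measurableD.
  move=> y; have /andP[hx0 hx1] := Lj.1 x; have /andP[hy0 hy1] := Lj.1 y.
  have xM : 0 <= `|x| / M by rewrite divr_ge0// ltW.
  have [yM|My] := leP M `|y|.
    by have ty := tail_eq1 M0 yM; rewrite ty; lra.
  have -> : tail M y = `|y| / M.
    have yM0 : 0 <= `|y| / M by rewrite divr_ge0// ltW.
    have yM1 : `|y| / M < 1 by rewrite ltr_pdivrMr// mul1r.
    move: yM0 yM1; rewrite /tail; move: (`|y| / M) => t t0 t1.
    by rewrite /clip; case: (leP t 0) => ?; case: (leP 1 t) => ?; lra.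
  have := Lj.2 x y; rewrite ler_norml => /andP[_ h].
  have {}h : iter j Pf (tail M) x - iter j Pf (tail M) y <= `|x| / M + `|y| / M.
    rewrite (le_trans h)// mulrC -mulrDl ler_wpM2r ?invr_ge0 ?(ltW M0)//.
    exact: ler_normB.
  lra.
rewrite expectD//; last exact: bounded_measurableD.
rewrite expectD// expect_cst (expect_invariant _ Lt) mulr_natl mulr2n//.
Qed.

Let cesaro_tight x (e : R) : 0 < e -> exists2 M : R, 0 < M &
  forall k, avg k (tail M) x <= e.
Proof.
move=> e0; have e40 : 0 < e / 4 by rewrite divr_gt0.
have [n _ ne] := tail_small pi0 e40.
have [m _ mx] := nbhs_infty_ger (`|x| / (e / 2)).
pose N := maxn n m; exists N.+1%:R => // k.
have k0 : 0 < k.+1%:R :> R by rewrite ltr0n.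
rewrite /cesaro_fun ler_pdivrMl//.
rewrite mulr_natl -[X in _ <= _ *+ X]card_ord -sumr_const.
apply: ler_sum => i _; rewrite (le_trans (iter_tail_le _ _ _))//.
have : \int[pi0]_y tail N.+1%:R y <= e / 4 by apply: ne; exact: leq_maxl.
have : `|x| / N.+1%:R <= e / 2.
  rewrite ler_pdivrMr// mulrC -ler_pdivrMr ?divr_gt0//.
  by rewrite (le_trans (mx N _)) ?ler_nat//=; exact: leq_maxr.
by move: (`|x| / _) (\int[pi0]_y _) => u v; lra.
Qed.

(** The Cauchy criterion, through the chain of approximations
    A_k f ~ A_k A_m f ~ A_k A_m' f = A_m' A_k f ~ A_m' f ~ A_m f at x. *)
Let cesaro_fun_cvg L (f : E -> R) x : unit_lipschitz L f -> cvgn (fun k => avg k f x).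
Proof.
move=> Lf; apply: cauchy_cvg; apply: cauchy_exP => e /= e0.
have e50 : 0 < e / 6 by rewrite divr_gt0.
have [M1 M10 M1x] := cesaro_tight x e50.
have La m := cesaro_fun_unit_lipschitz xi nonexp m Lf.
(* The ball has to contain x, where A_m f and A_m' f are compared at the end. *)
pose M := Num.max M1 `|x|.
have [m mP] := unit_lipschitz_subsequence M e50 La.
have [k0 _ k0P] := nbhs_infty_ger (m.+1%:R / (e / 6)).
exists (avg m f x); exists k0 => // k /= k0k.
have ke : m.+1%:R / k.+1%:R <= e / 6.
  rewrite ler_pdivrMr// mulrC -ler_pdivrMr//.
  by rewrite (le_trans (k0P k k0k))// ler_nat.
have [m1 _ m1P] := nbhs_infty_ger (k.+1%:R / (e / 6)).
have [m' mm' FF] := mP m1.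
have me : k.+1%:R / m'.+1%:R <= e / 6.
  rewrite ler_pdivrMr// mulrC -ler_pdivrMr//.
  by rewrite (le_trans (m1P m' mm'))// ler_nat.
have h1 := le_trans (cesaro_fun_cesaro_fun xi nonexp k m x Lf) ke.
have h2 := le_trans (cesaro_fun_cesaro_fun xi nonexp m' k x Lf) me.
have h3 : `|avg m f x - avg m' f x| <= e / 6 by apply: FF; rewrite le_max lexx orbT.
have h4 : `|avg k (avg m f) x - avg k (avg m' f) x| <= e / 6 + e / 6.
  rewrite -(expect_dirac x (cesaro_fun_unit_lipschitz xi nonexp k (La m))).
  rewrite -(expect_dirac x (cesaro_fun_unit_lipschitz xi nonexp k (La m'))).
  rewrite -!(expect_cesaro xi nonexp _ _ (La _)).
  have bm n := unit_lipschitz_bounded_measurable (La n).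
  rewrite -expectB//.
  have Lt := @tail_unit_lipschitz R E M1 M10.
  have bt := unit_lipschitz_bounded_measurable Lt.
  rewrite (@le_trans _ _ (\int[cesaro_mean xi T (\d_(x : borel E)) k]_y
      (e / 6 + tail M1 y)))//.
    apply: norm_expect_le.
    - exact: bounded_measurableB.
    - exact: bounded_measurableD.
    - move=> y; have t0 := unit_lipschitz_ge0 y Lt.
      have [yM|My] := leP `|y| M.
        by rewrite (le_trans (FF _ yM))// lerDl.
      rewrite tail_eq1//; last by rewrite (le_trans _ (ltW My))// le_max lexx.
      rewrite (le_trans (dist01_le1 ((La m).1 y) ((La m').1 y)))//.
      by rewrite lerDr ltW.
  rewrite expectD// expect_cst lerD2l (expect_cesaro xi nonexp _ _ Lt).
  by rewrite (expect_dirac x (cesaro_fun_unit_lipschitz xi nonexp k Lt)).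
rewrite -ball_normE/=.
move: h2 h4; rewrite (cesaro_funC xi nonexp _ _ _ Lf) => h2 h4.
move: h1 h2 h3 h4; rewrite !ler_norml ltr_norml; lra.
Qed.

(** Q f and f have the same limit averages, as A_k Q f - A_k f tends to 0. *)
Lemma weak_limit_invariant (mu pi : probability (borel E) R) :
  (forall L (f : E -> R), unit_lipschitz L f ->
    \int[cesaro_mean xi T mu k]_x f x @[k --> \oo] --> \int[pi]_x f x) ->
  invariant_probability xi T pi.
Proof.
move=> mupi; apply: (@probability_ext_expect R E (markov_op xi T pi) pi) => L f Lf.
rewrite (expect_markov_op xi T pi Lf).
have LP := markov_fun_unit_lipschitz xi nonexp Lf.
apply/eqP; rewrite -subr_eq0 -normr_le0.
have cesaro_cvg (g : E -> R) : unit_lipschitz L g ->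
    \int[mu]_x avg k g x @[k --> \oo] --> \int[pi]_x g x.
  move=> Lg; have := mupi _ _ Lg.
  rewrite (_ : (fun k => _) = fun k => \int[mu]_x avg k g x)//.
  by apply/funext => k; exact: (expect_cesaro xi nonexp mu k Lg).
have cd : `|\int[mu]_x avg k (Pf f) x - \int[mu]_x avg k f x| @[k --> \oo] -->
    `|\int[pi]_x Pf f x - \int[pi]_x f x|.
  by apply: cvg_norm; apply: cvgB; [exact: cesaro_cvg LP|exact: cesaro_cvg Lf].
apply: (ler_cvg_to cd (@cvg_harmonic R)); apply: nearW => k.
have La := cesaro_fun_unit_lipschitz xi nonexp k Lf.
have LaP := cesaro_fun_unit_lipschitz xi nonexp k LP.
have ba := unit_lipschitz_bounded_measurable La.
have baP := unit_lipschitz_bounded_measurable LaP.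
rewrite -expectB//.
rewrite [leRHS](_ : _ = \int[mu]_x k.+1%:R^-1); last by rewrite expect_cst.
apply: norm_expect_le => //.
  exact: bounded_measurableB.
move=> x; have := cesaro_fun_iter xi nonexp k 1 x Lf.
by rewrite div1r.
Qed.

Lemma cesaro_dirac_weak_limit (x : E) : exists pi : probability (borel E) R,
  forall L (f : E -> R), unit_lipschitz L f ->
    avg k f x @[k --> \oo] --> \int[pi]_y f y.
Proof.
have aE L f k : unit_lipschitz L f ->
    \int[cesaro_mean xi T (\d_(x : borel E)) k]_y f y = avg k f x.
  move=> Lf; rewrite (expect_cesaro xi nonexp _ _ Lf).
  exact: expect_dirac (cesaro_fun_unit_lipschitz xi nonexp k Lf).
have [] := @tight_weak_limit R E (fun k => cesaro_mean xi T (\d_(x : borel E)) k).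
- move=> e /(cesaro_tight x)[M M0 Me]; exists M => // k.
  by rewrite (aE _ _ _ (@tail_unit_lipschitz R E M M0)).
- move=> L f Lf; rewrite (_ : (fun k => _) = (fun k => avg k f x)).
    exact: cesaro_fun_cvg Lf.
  by apply/funext => k; exact: aE Lf.
move=> pi piP; exists pi => L f Lf; have := piP L f Lf.
rewrite (_ : (fun k => _) = (fun k => avg k f x))//.
by apply/funext => k; exact: aE Lf.
Qed.

End ergodic.

(** * The limit theorem *)

Theorem theorem2p8 (R : realType) (E : euclideanType R)
    (dO dI : measure_display) (Omega : measurableType dO)
    (I : measurableType dI) (P : probability Omega R) (xi : {RV P >-> I})
    (T : {mfun (borel E * I)%type >-> borel E})
    (mu : probability (borel E) R) :
  (forall i : I, nonexpansive (fun x : E => T (x, i))) ->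
  (exists pi : probability (borel E) R, invariant_probability xi T pi) ->
  exists (pi_mu : probability (borel E) R)
         (pi_ : E -> probability (borel E) R),
    [/\ invariant_probability xi T pi_mu,
        prokhorov_cvg (fun k => cesaro_mean xi T mu k) pi_mu,
        forall x, supp mu x ->
          invariant_probability xi T (pi_ x) /\
          prokhorov_cvg (fun k => cesaro_mean xi T (\d_(x : borel E)) k) (pi_ x)
      & forall A : set (borel E), measurable A ->
          measurable_fun (supp mu : set (borel E)) (fun x => pi_ x A) /\
          pi_mu A = (\int[mu]_(x in supp mu) pi_ x A)%E].
Proof.
move=> nonexp [pi0 pi0_inv].
have /choice[pi_ pi_P] := cesaro_dirac_weak_limit nonexp pi0_inv.
have mpi : forall A : set (borel E), measurable A ->
    measurable_fun [set: borel E] (fun x => pi_ x A).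
  apply: measurable_kernel_weak => L f Lf.
  apply: (@measurable_fun_cvg _ (borel E) R _ (fun k x => cesaro_fun xi T k f x)).
    move=> k; have := cesaro_fun_unit_lipschitz xi nonexp k Lf.
    by move=> /unit_lipschitz_bounded_measurable[].
  by move=> x _; exact: pi_P Lf.
have [pi_mu pi_muE] := mixture_exists mu mpi.
(* Dominated convergence of A_k f, which converges at every point. *)
have pi_mu_cvg L (f : E -> R) : unit_lipschitz L f ->
    \int[cesaro_mean xi T mu k]_x f x @[k --> \oo] --> \int[pi_mu]_x f x.
  move=> Lf; have bf := unit_lipschitz_bounded_measurable Lf.
  rewrite (_ : (fun k => _) = fun k => \int[mu]_x cesaro_fun xi T k f x); last first.
    by apply/funext => k; exact: (expect_cesaro xi nonexp mu k Lf).
  rewrite (expect_mixture mpi pi_muE bf); last by move=> y; exact: unit_lipschitz_ge0 Lf.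
  have Lk k := cesaro_fun_unit_lipschitz xi nonexp k Lf.
  apply: (@expect_cvg _ (borel E) R mu _ _ 1) => [k|k x|x].
  - by have [] := unit_lipschitz_bounded_measurable (Lk k).
  - by rewrite ger0_norm ?(unit_lipschitz_ge0 _ (Lk k))// (unit_lipschitz_le1 _ (Lk k)).
  - exact: pi_P Lf.
have pi_cvg x L (f : E -> R) : unit_lipschitz L f ->
    \int[cesaro_mean xi T (\d_(x : borel E)) k]_y f y @[k --> \oo] -->
    \int[pi_ x]_y f y.
  move=> Lf.
  rewrite (_ : (fun k => _) = fun k => cesaro_fun xi T k f x); first exact: pi_P Lf.
  apply/funext => k; rewrite (expect_cesaro xi nonexp _ k Lf).
  exact: expect_dirac (cesaro_fun_unit_lipschitz xi nonexp k Lf).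
exists pi_mu, pi_; split.
- exact: weak_limit_invariant pi_mu_cvg.
- exact: weak_prokhorov pi_mu_cvg.
- move=> x _; split; first exact: weak_limit_invariant (pi_cvg x).
  exact: weak_prokhorov (pi_cvg x).
- move=> A mA; have mS := measurable_supp mu.
  split; first exact: measurable_funS (mpi A mA).
  rewrite pi_muE// (@ge0_negligible_integral _ _ _ mu setT (~` supp mu))//.
  + by rewrite setTD setCK.
  + exact: measurableC.
  + exact: mpi.
  + exact: supp_complement_null.
Qed.
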